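(* Let $\mathcal{F}$ be a finite class of functions $\mathcal{X}\times\mathcal{A}\to[0,1]$, $\mathcal{G}$ a finite class of functions $\mathcal{X}\to[0,1]$, and $\Pi$ a finite class of policies $\mathcal{X}\to\Delta(\mathcal{A})$. Assume realizability and completeness of $(\mathcal{F},\mathcal{G},\Pi)$ (as defined in the context). Let $\pi^\dagger$ denote the policy learned by CODA+PSPI (defined in the context) from the datasets $D_{\mathrm{dyn}}$ and $D_{\mathrm{goal}}$. Then with probability at least $1-\delta$, for any $\pi\in\Pi$, $$J(\pi)-J(\pi^\dagger)\;\lesssim\;\mathfrak{C}_{\mathrm{dyn}}(\pi)\left(\sqrt{\frac{\log(|\mathcal{F}||\mathcal{G}||\Pi|/\delta)}{|D_{\mathrm{dyn}}|}}+\sqrt{\frac{\log(|\mathcal{F}||\mathcal{G}||\Pi|/\delta)}{|D_{\mathrm{goal}}|}}\right)+\mathfrak{C}_{\mathrm{goal}}(\pi)\sqrt{\frac{\log(|\mathcal{G}|/\delta)}{|D_{\mathrm{goal}}|}},$$ where $\mathfrak{C}_{\mathrm{dyn}}(\pi)$ and $\mathfrak{C}_{\mathrm{goal}}(\pi)$ are the concentrability coefficients defined in the context.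
   Context: **CGO problem.** A contextual goal-oriented (CGO) problem has a state space $\mathcal{S}$, action space $\mathcal{A}$, context space $\mathcal{C}$, transition kernel $P:\mathcal{S}\times\mathcal{A}\to\Delta(\mathcal{S})$ (independent of the context), discount $\gamma\in[0,1)$, an initial distribution $d_0$ over pairs $(s_0,c)$, and for each $c\in\mathcal{C}$ a goal set $G_c\subset\mathcal{S}$. $\Delta(\cdot)$ denotes the space of distributions. Let $\mathcal{X}=\mathcal{S}\times\mathcal{C}$ and $G=\{(s,c)\in\mathcal{X}: s\in G_c\}$. Let $s^+\notin\mathcal{S}$ be a fictitious absorbing state, $\bar{\mathcal{S}}=\mathcal{S}\cup\{s^+\}$, $\bar{\mathcal{X}}=\bar{\mathcal{S}}\times\mathcal{C}$, $\mathcal{X}^+=\{(s^+,c):c\in\mathcal{C}\}$. The reward is $R(x)=\mathbb{1}(x\in G)$ (zero on $\mathcal{X}^+$). **Original MDP.** Contexts never change. From $x=(s,c)$ with $s\in G_c$ or $s=s^+$, every action leads to $(s^+,c)$; otherwise, under action $a$, the next state is $(s',c)$ with $s'\sim P(\cdot|s,a)$. For $\pi:\mathcal{X}\to\Delta(\mathcal{A})$ (actions on $\mathcal{X}^+$ are irrelevant), $Q^\pi(x,a)=\mathbb{E}_{\pi,P}[\sum_{t\ge0}\gamma^tR(x_t)\mid x_0=x,a_0=a]$ and $J(\pi)=\mathbb{E}_{x_0\sim d_0}\mathbb{E}_{a\sim\pi(\cdot|x_0)}[Q^\pi(x_0,a)]$. For any $f$, write $f(x,\pi)=\mathbb{E}_{a\sim\pi(\cdot|x)}[f(x,a)]$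 and $f(d_0,\pi)=\mathbb{E}_{x_0\sim d_0}[f(x_0,\pi)]$. **Data.** $D_{\mathrm{dyn}}=\{(s_i,a_i,s_i')\}$ consists of i.i.d. samples from $\mu_{\mathrm{dyn}}(s,a,s')$, with $\mu_{\mathrm{dyn}}(s'|s,a)=P(s'|s,a)$. $D_{\mathrm{goal}}=\{(s_j,c_j)\}$ consists of i.i.d. samples from $\mu_{\mathrm{goal}}(s,c)$, which satisfies $\mu_{\mathrm{goal}}(s|c)>0\Rightarrow s\in G_c$. **Assumptions.** Let $\mathcal{T}^\pi f(x,a)=\gamma\,\mathbb{E}_{x'\sim P_0(\cdot|x,a)}[f(x',\pi)]$, where $P_0(x'|x,a)=P(s'|s,a)\mathbb{1}(c'=c)$. *Realizability*: for all $\pi\in\Pi$, $Q^\pi\in\mathcal{F}$, and $R\in\mathcal{G}$. *Completeness*: for all $f\in\mathcal{F}$, $g\in\mathcal{G}$, $\pi\in\Pi$, the function $(x,a)\mapsto\max(g(x),f(x,\pi))$ is in $\mathcal{F}$, and $\mathcal{T}^\pi f\in\mathcal{F}$. **Concentrability.** $\|h\|_\mu^2=\mathbb{E}_\mu[h^2]$ (also for unnormalized $\mu$), and $$\mathfrak{C}_{\mathrm{dyn}}(\pi)=\max_{f,f'\in\mathcal{F}}\frac{\|f-\mathcal{T}^\pi f'\|^2_{\rho^\pi_{\notin G}}}{\|f-\mathcal{T}^\pi f'\|^2_{\mu_{\mathrm{dyn}}}},\qquad \mathfrak{C}_{\mathrm{goal}}(\pi)=\max_{g\in\mathcal{G}}\frac{\|g-R\|^2_{\rho^\pi_{\in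 G}}}{\|g-R\|^2_{\mu_{\mathrm{goal}}}},$$ where $\rho^\pi_{\notin G}(x,a)=\mathbb{E}_{\pi,P}[\sum_{t=0}^{T-1}\gamma^t\mathbb{1}(x_t=x,a_t=a)]$, $\rho^\pi_{\in G}(x)=\mathbb{E}_{\pi,P}[\gamma^T\mathbb{1}(x_T=x)]$, trajectories start from $d_0$, and $T$ is the first time the agent enters $G$ ($\gamma^T=0$ if $T=\infty$). In the norm on functions of $(x,a)=((s,c),a)$, $\mu_{\mathrm{dyn}}$ means the product $\mu_{\mathrm{dyn}}(s,a)\mu_{\mathrm{goal}}(c)$. **CODA+PSPI.** Build $\bar D_{\mathrm{dyn}}=\{((s_i,c_j),a_i,0,(s_i',c_j)): (s_i,a_i,s_i')\in D_{\mathrm{dyn}},(\cdot,c_j)\in D_{\mathrm{goal}}\}$ and $\bar D_{\mathrm{goal}}=\{((s_n,c_n),a^+,1,(s^+,c_n)):(s_n,c_n)\in D_{\mathrm{goal}}\}$, with $a^+\notin\mathcal{A}$ a fictitious action. For $f\in\mathcal{F},g\in\mathcal{G}$ let $\bar f_g$ be the function on $\bar{\mathcal{X}}\times(\mathcal{A}\cup\{a^+\})$ equal to $0$ on $\mathcal{X}^+$, to $g(x)$ if $a=a^+$, $x\notin\mathcal{X}^+$, and to $f(x,a)$ otherwise; let $\bar{\mathcal{F}}$ be the set of all such $\bar f_g$. The extension $\bar\pi$ of $\pi$ plays $\pi(\cdot|x)$ for $x\notin G$ and $a^+$ for $x\in G$. Define $$\ell_{\mathrm{dyn}}(\bar f_g,\bar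 f'_{g'};\bar\pi)=\frac1{|\bar D_{\mathrm{dyn}}|}\sum_{(x,a,r,x')\in\bar D_{\mathrm{dyn}}}\bigl(f(x,a)-\gamma\max(g'(x'),f'(x',\pi))\bigr)^2,\quad \ell_{\mathrm{goal}}(\bar f_g)=\frac1{|\bar D_{\mathrm{goal}}|}\sum_{(x,a,r,x')\in\bar D_{\mathrm{goal}}}(g(x)-1)^2.$$ The learned policy $\pi^\dagger$ is the solution of $$\max_{\pi\in\Pi}\ \min_{\bar f_g\in\bar{\mathcal{F}}}\ \bar f_g(d_0,\bar\pi)\quad\text{s.t.}\quad \ell_{\mathrm{dyn}}(\bar f_g,\bar f_g;\bar\pi)-\min_{\bar f'_{g'}\in\bar{\mathcal{F}}}\ell_{\mathrm{dyn}}(\bar f'_{g'},\bar f_g;\bar\pi)\le\epsilon_{\mathrm{dyn}},\quad \ell_{\mathrm{goal}}(\bar f_g)\le0,$$ where $\epsilon_{\mathrm{dyn}}$ equals $\bigl(\sqrt{\square/|D_{\mathrm{dyn}}|}+\sqrt{\square/|D_{\mathrm{goal}}|}\bigr)^2$ times a sufficiently large absolute constant, with $\square=\log(|\mathcal{F}||\mathcal{G}||\Pi|/\delta)$. (When $d_0$ puts no mass on $G$, $\bar f_g(d_0,\bar\pi)=f(d_0,\pi)$.) $\lesssim$ hides a multiplicative constant not depending on the dataset sizes, the classes $\mathcal{F},\mathcal{G},\Pi$, $\delta$, or $\pi$.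
   Formalization: The maxima defining both concentrability coefficients always contain a ratio 0/0 (g = R; f = T^π f'); it is read as 1, so both coefficients are at least 1. If such ratios were discarded, the bound would be false. *)

(* Defs.v *)
From HB Require Import structures.
From mathcomp Require Import all_boot all_order all_algebra.
From mathcomp Require Import finmap.
From mathcomp Require Import all_classical all_reals all_analysis.
Set Implicit Arguments.
Unset Strict Implicit.
Unset Printing Implicit Defensive.
Import Order.TTheory GRing.Theory Num.Theory.
Import numFieldNormedType.Exports.
Local Open Scope classical_set_scope.
Local Open Scope ring_scope.

(* Number of elements of a finite set; [{classic T}] only supplies the
   [choiceType] structure required by [fset_set]. *)
Definition card_set (T : Type) (A : set T) : nat :=
  #|` fset_set (A : set {classic T}) |.

(* [||h||_mu ^2]; [mu] is only a set function here because the occupancy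
   measures below are not packaged as measures. *)
Definition sqnorm (R : realType) (d : measure_display) (T : measurableType d)
    (mu : set T -> \bar R) (h : T -> R) : \bar R :=
  (\int[mu]_z ((h z) ^+ 2)%:E)%E.

(* Ratio of nonnegative extended reals.  For [a > 0] the library's division
   already gives [a / 0 = +oo]; it also gives [0 / 0 = 0], which is replaced
   here by [0 / 0 = 1] (equal quantities have ratio one).  Under realizability
   and completeness both concentrability coefficients contain a ratio [0 / 0]
   (from [g = R], and from [f = T^pi f']), so this convention makes them at
   least one.  It cannot be dropped: with [0 / 0] discarded the coefficients
   can be arbitrarily small, and since the regret is of the order of their
   square roots, a bound linear in them would be false. *)
Definition ratio (R : realType) (a b : \bar R) : \bar R :=
  if (a == 0%E) && (b == 0%E) then 1%E else (a / b)%E.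

Record cgo (R : realType) (dS dA dC : measure_display) (S : measurableType dS)
    (A : measurableType dA) (C : measurableType dC) := CGO {
  trans : R.-pker (S * A)%type ~> S ;
  discount : R ;
  init : probability (S * C)%type R ;
  goal : C -> set S ;
  discount_ge0 : 0 <= discount ;
  discount_lt1 : discount < 1 ;
  measurable_goal : measurable [set x : S * C | goal x.2 x.1] }.

Section cgo_problem.
Context {R : realType} {dS dA dC : measure_display} {S : measurableType dS}
  {A : measurableType dA} {C : measurableType dC}.
Variable M : cgo R S A C.

Local Notation X := (S * C)%type.
Local Notation XA := (S * C * A)%type.
(* [None] is the fictitious absorbing state [s^+] *)
Local Notation Xbar := (option S * C)%type.
(* [None] is the fictitious action [a^+] *)
Local Notation Abar := (option A).
Local Notation policy := (R.-pker (S * C)%type ~> A).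
Local Notation gamma := (discount M).

Definition inX (x : X) : Xbar := (Some x.1, x.2).

Definition goalX : set X := [set x | goal M x.2 x.1].

Definition goalXbar : set Xbar := inX @` goalX.

Definition reward (x : Xbar) : R := \1_goalXbar x.

(* Trajectories of the original MDP.  A path up to time [t] is the sequence
   [:: (x_0, a_0); ...; (x_t, a_t)].  The expectation of a function of such a
   path is the iterated integral by which the Ionescu-Tulcea theorem
   characterizes the law of the trajectory. *)

(* [E_(a ~ pi(.|x)) [F a]]; the action played at an absorbing state is
   irrelevant and fixed to an arbitrary [point]. *)
Definition act_exp (pi : policy) (x : Xbar) (F : A -> \bar R) : \bar R :=
  if x is (Some s, c) then (\int[pi (s, c)]_a F a)%E else F point.

(* expectation over the next state *)
Definition step_exp (x : Xbar) (a : A) (F : Xbar -> \bar R) : \bar R :=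
  if x is (Some s, c) then
    if `[< goal M c s >] then F (None, c)
    else (\int[trans M (s, a)]_s' F (Some s', c))%E
  else F (None, x.2).

(* [E [Phi ((x_0, a_0), ..., (x_(k+t), a_(k+t)))]] given the first [k] steps [h]
   of the path and [(x_k, a_k) = (x, a)] *)
Fixpoint path_exp (pi : policy) (t : nat) (h : seq (Xbar * A)) (x : Xbar) (a : A)
    (Phi : seq (Xbar * A) -> \bar R) : \bar R :=
  if t is t'.+1 then
    step_exp x a (fun x' => act_exp pi x' (fun a' =>
      path_exp pi t' (rcons h (x, a)) x' a' Phi))
  else Phi (rcons h (x, a)).

(* [E_(pi,P) [\sum_(t >= 0) Z_t | x_0 = x, a_0 = a]] for nonnegative [Z_t]
   depending on the path up to time [t] *)
Definition traj_exp_from (pi : policy) (Z : nat -> seq (Xbar * A) -> \bar R)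
    (x : Xbar) (a : A) : \bar R :=
  (\sum_(0 <= t <oo) path_exp pi t [::] x a (Z t))%E.

(* the same expectation with [x_0 ~ d_0] and [a_0 ~ pi(.|x_0)] *)
Definition traj_exp (pi : policy) (Z : nat -> seq (Xbar * A) -> \bar R) : \bar R :=
  (\int[init M]_x act_exp pi (inX x) (fun a => traj_exp_from pi Z (inX x) a))%E.

(* [(x_t, a_t)] for a path up to time [t]; the default is never used *)
Definition current (h : seq (Xbar * A)) : Xbar * A :=
  last ((None, point), point) h.

(* First time the path visits [G], or its length [t+1] if [G] is not visited up
   to time [t]: for such a path [t < T] and [T = t] are decided by
   [t < hit_time h] and [hit_time h == t]. *)
Definition hit_time (h : seq (Xbar * A)) : nat :=
  find (fun z : Xbar * A => `[< goalXbar z.1 >]) h.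

Definition Qfun (pi : policy) (x : Xbar) (a : A) : \bar R :=
  traj_exp_from pi (fun t h => (gamma ^+ t * reward (current h).1)%:E) x a.

Definition Jval (pi : policy) : \bar R :=
  (\int[init M]_x \int[pi x]_a Qfun pi (inX x) a)%E.

Definition occ_notin (pi : policy) (B : set XA) : \bar R :=
  traj_exp pi (fun t h =>
    (if (t < hit_time h)%N
     then gamma ^+ t * \1_[set (inX z.1, z.2) | z in B] (current h)
     else 0)%:E).

Definition occ_in (pi : policy) (B : set X) : \bar R :=
  traj_exp pi (fun t h =>
    (if hit_time h == t
     then gamma ^+ t * \1_(inX @` B) (current h).1
     else 0)%:E).

(* [f(x, pi)] *)
Definition pol_eval (f : XA -> R) (pi : policy) (x : X) : R :=
  \int[pi x]_a f (x, a).

(* [T^pi f], where the next state follows [P_0], which ignores the goal set *)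
Definition bellman (pi : policy) (f : XA -> R) (z : XA) : R :=
  gamma * \int[trans M (z.1.1, z.2)]_s' pol_eval f pi (s', z.1.2).

Section function_classes.
Variables (F : set (XA -> R)) (G : set (X -> R)) (Pi : set policy).

Definition unit_valued (T : Type) (f : T -> R) : Prop := forall z, 0 <= f z <= 1.

Definition admissible_classes : Prop :=
  [/\ finite_set F, finite_set G, finite_set Pi,
      (forall f, F f -> measurable_fun setT f /\ unit_valued f) &
      (forall g, G g -> measurable_fun setT g /\ unit_valued g)].

Definition realizability : Prop :=
  (forall pi, Pi pi -> F (fun z => fine (Qfun pi (inX z.1) z.2))) /\
  G (fun x => reward (inX x)).

Definition completeness : Prop :=
  forall f g pi, F f -> G g -> Pi pi ->
    F (fun z => Num.max (g z.1) (pol_eval f pi z.1)) /\ F (bellman pi f).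

Section data_distributions.
Variables (mu_dyn : probability (S * A * S)%type R) (mu_goal : probability X R).

(* [mu_dyn(s'|s,a) = P(s'|s,a)] *)
Definition dyn_consistent : Prop :=
  forall (U : set (S * A)) (V : set S), measurable U -> measurable V ->
    mu_dyn (U `*` V) = (\int[mu_dyn]_(z in U `*` setT) trans M z.1 V)%E.

(* [mu_goal(s|c) > 0 -> s \in G_c], for a distribution that need not have a
   mass function *)
Definition goal_consistent : Prop := mu_goal (~` goalX) = 0%E.

(* the law [mu_dyn(s, a) mu_goal(c)] of [((s, c), a)] *)
Definition mu_dyn_prod : set XA -> \bar R :=
  pushforward (mu_dyn \x mu_goal)%E
    (fun w : S * A * S * X => ((w.1.1.1, w.2.2), w.1.1.2)).

Definition conc_dyn (pi : policy) : \bar R :=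
  ereal_sup [set y | exists f f', [/\ F f, F f' &
    y = ratio (sqnorm (occ_notin pi) (fun z => f z - bellman pi f' z))
              (sqnorm mu_dyn_prod (fun z => f z - bellman pi f' z))]].

Definition conc_goal (pi : policy) : \bar R :=
  ereal_sup [set y | exists2 g, G g &
    y = ratio (sqnorm (occ_in pi) (fun x => g x - reward (inX x)))
              (sqnorm mu_goal (fun x => g x - reward (inX x)))].

(* The datasets: all [n + m] samples are mutually independent, the first [n]
   with law [mu_dyn] and the last [m] with law [mu_goal]. *)
Definition iid_samples (dO : measure_display) (Omega : measurableType dO)
    (Pr : probability Omega R) (n m : nat)
    (Ddyn : 'I_n -> Omega -> S * A * S) (Dgoal : 'I_m -> Omega -> X) : Prop :=
  [/\ (forall i, measurable_fun setT (Ddyn i)),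
      (forall j, measurable_fun setT (Dgoal j)) &
      forall (U : 'I_n -> set (S * A * S)) (V : 'I_m -> set X),
        (forall i, measurable (U i)) -> (forall j, measurable (V j)) ->
        Pr [set w | (forall i, U i (Ddyn i w)) /\ (forall j, V j (Dgoal j w))] =
        ((\prod_(i < n) mu_dyn (U i)) * (\prod_(j < m) mu_goal (V j)))%E].

End data_distributions.

(* [\bar f_g] is encoded by the pair [u = (f, g)], which it determines. *)
Definition fbar (u : (XA -> R) * (X -> R)) (x : Xbar) (a : Abar) : R :=
  if x is (Some s, c) then
    if a is Some b then u.1 ((s, c), b) else u.2 (s, c)
  else 0.

Definition Fbar : set ((XA -> R) * (X -> R)) := F `*` G.

(* [E_(a ~ \bar pi(.|x)) [h a]]: [\bar pi] plays [a^+] on [G], and [pi] elsewhere *)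
Definition ext_pol_exp (pi : policy) (x : X) (h : Abar -> R) : R :=
  if `[< goalX x >] then h None else \int[pi x]_a h (Some a).

(* [\bar f_g(d_0, \bar pi)] *)
Definition fbar_value (pi : policy) (u : (XA -> R) * (X -> R)) : R :=
  \int[init M]_x ext_pol_exp pi x (fbar u (inX x)).

Definition aug_dyn (D : seq (S * A * S)) (E : seq X) : seq (X * A * R * X) :=
  [seq ((z.1.1, y.2), z.1.2, 0, (z.2, y.2)) | z <- D, y <- E].

Definition aug_goal (E : seq X) : seq (X * Abar * R * Xbar) :=
  [seq (y, None, 1, (None, y.2)) | y <- E].

Definition loss_dyn (D : seq (X * A * R * X)) (u v : (XA -> R) * (X -> R))
    (pi : policy) : R :=
  (size D)%:R^-1 * \sum_(w <- D)
    (u.1 w.1.1 - gamma * Num.max (v.2 w.2) (pol_eval v.1 pi w.2)) ^+ 2.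

Definition loss_goal (D : seq (X * Abar * R * Xbar)) (u : (XA -> R) * (X -> R)) : R :=
  (size D)%:R^-1 * \sum_(w <- D) (u.2 w.1.1.1 - 1) ^+ 2.

Definition feasible (Ddyn : seq (S * A * S)) (Dgoal : seq X) (eps : R)
    (pi : policy) : set ((XA -> R) * (X -> R)) :=
  [set u | [/\ Fbar u,
    loss_dyn (aug_dyn Ddyn Dgoal) u u pi -
      inf [set loss_dyn (aug_dyn Ddyn Dgoal) v u pi | v in Fbar] <= eps &
    loss_goal (aug_goal Dgoal) u <= 0]].

(* [+oo] if no [\bar f_g] is feasible *)
Definition pessimistic_value (Ddyn : seq (S * A * S)) (Dgoal : seq X) (eps : R)
    (pi : policy) : \bar R :=
  ereal_inf [set (fbar_value pi u)%:E | u in feasible Ddyn Dgoal eps pi].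

Definition coda_pspi (Ddyn : seq (S * A * S)) (Dgoal : seq X) (eps : R)
    (pi : policy) : Prop :=
  Pi pi /\ forall pi', Pi pi' ->
    (pessimistic_value Ddyn Dgoal eps pi' <= pessimistic_value Ddyn Dgoal eps pi)%E.

(* [\log (|F| |G| |Pi| / delta)] *)
Definition log_all (delta : R) : R :=
  ln ((card_set F * card_set G * card_set Pi)%:R / delta).

(* [\log (|G| / delta)] *)
Definition log_goal (delta : R) : R := ln ((card_set G)%:R / delta).

Definition rate_dyn (delta : R) (n m : nat) : R :=
  Num.sqrt (log_all delta / n%:R) + Num.sqrt (log_all delta / m%:R).

Definition rate_goal (delta : R) (m : nat) : R :=
  Num.sqrt (log_goal delta / m%:R).

End function_classes.
End cgo_problem.

(* Main.v *)
(** Off the goal set, the true value is a fixed point of the sampled Bellman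
    operator [f |-> T^pi (max (g, f(., pi)))] with [g = R].  The pair formed by
    this fixed point and [R] is feasible with high probability, so the
    pessimistic value of [pi^dagger] is at most [J(pi^dagger)], and by optimality
    so is the pessimistic value of every [pi].  Conversely, for a feasible pair
    [(f, g)] the squared Bellman error of [f] under [mu_dyn] and the squared
    error of [g] under [mu_goal] are of the order of the squared rates.  The
    performance difference [J(pi) - f_g(d_0, pi)] is at most the sum of the
    occupancy integrals of the two errors; by AM-GM,
    [|e| <= e^2 / (2 rate) + rate / 2], and the change of measure from occupancy
    to data costs one concentrability coefficient, which is at least one.

    The squared loss is compared at fast rate: the difference of two losses has
    a conditional variance bounded by its mean, which makes
    [exp (- difference / 8 + mean / 16)] have expectation at most one.  The
    dynamics and goal samples are combined in all pairs; for a fixed context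
    the dynamics samples are still independent, and the average over contexts
    is pulled out of the exponential by convexity. *)

Require Import Defs.
From HB Require Import structures.
From mathcomp Require Import all_boot all_order all_algebra.
From mathcomp Require Import finmap.
From mathcomp Require Import all_classical all_reals all_analysis.
From mathcomp Require Import measurable_realfun giry.
From mathcomp Require Import ring lra.
Set Implicit Arguments.
Unset Strict Implicit.
Unset Printing Implicit Defensive.
Import Order.TTheory GRing.Theory Num.Theory.
Import numFieldNormedType.Exports.
Local Open Scope classical_set_scope.
Local Open Scope ring_scope.

(** Trajectory expectations are iterated integrals and occupancies are bare set functions, so
    linearity, monotone convergence and even nonnegativity of their integrals have to be earned.
    Everything is therefore expressed through one functional, [value], built from the resolvent of
    the discounted step killed at the goal. It is a positive operator, and on indicators cut down to
    the goal set or its complement it gives the two occupancies. For general integrands only one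
    inequality between [value] and the occupancy integral is proved, the one the regret bound uses.
    Upper bounds on [value] come from supersolutions [w + L v <= v], which replace the usual
    telescoping sum and avoid subtracting extended reals. AM-GM, unlike Cauchy-Schwarz, is pointwise
    and so passes directly through a positive operator.

    On the statistical side, independence is given on rectangles only: samples are peeled off one at
    a time, and all failure probabilities are merged into a single Markov inequality. *)

(** * Measures, kernels and independence on product spaces *)

Lemma measure_eq_on_rectangles (R : realType) (d1 d2 : measure_display)
    (T1 : measurableType d1) (T2 : measurableType d2)
    (m1 m2 : {measure set (T1 * T2) -> \bar R}) :
  (m1 setT < +oo)%E ->
  (forall A B, measurable A -> measurable B -> m1 (A `*` B) = m2 (A `*` B)) ->
  forall B, measurable B -> m1 B = m2 B.
Proof.
move=> fin1 m12 B mB.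
apply: (measure_unique [set A `*` B | A in measurable & B in measurable]
  (fun=> setT)) => //.
- by rewrite -measurable_prod_measurableType.
- move=> _ _ [A1 mA1 [B1 mB1 <-]] [A2 mA2 [B2 mB2 <-]].
  exists (A1 `&` A2); first exact: measurableI.
  by exists (B1 `&` B2); [exact: measurableI|rewrite setXI].
- by move=> _; exists setT => //; exists setT => //; rewrite setXTT.
- by apply/seteqP; split => // x _; exists 0%N.
- by move=> _ [A1 mA1 [B1 mB1 <-]]; exact: m12.
Qed.

Section kernel_disintegration.
Context {R : realType} {d1 d2 : measure_display} {T1 : measurableType d1}
  {T2 : measurableType d2} (k : R.-pker T1 ~> T2).

(** A copy of [k x] that carries the probability structure required of a point of [giry]. *)
Definition kernel_at (x : T1) : set T2 -> \bar R := k x.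

HB.instance Definition _ (x : T1) := isMeasure.Build _ _ _ (kernel_at x)
  (measure0 (k x)) (measure_ge0 (k x)) (@measure_semi_sigma_additive _ _ _ (k x)).
HB.instance Definition _ (x : T1) :=
  Measure_isProbability.Build _ _ _ (kernel_at x) (prob_kernel (s := k) x).

(** The law of [(x, y)] with [x = z.1] and [y] drawn from [k x]. Indexed by the whole pair [z], it
    can be bound against [mu] directly, without passing to a marginal. *)
Definition graph_law (z : T1 * T2) : giry (T1 * T2)%type R :=
  giry_map (pair1_measurable z.1) (kernel_at z.1 : giry T2 R).

Lemma measurable_graph_law : measurable_fun setT graph_law.
Proof.
apply: measurable_giry_codensity => // B mB.
rewrite (_ : graph_law ^~ B = (fun x => k x (xsection B x)) \o fst).
  apply: measurableT_comp => //.
  by apply: measurable_fun_xsection_finite_kernel; exact: mem_set.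
apply/funext => z; rewrite /graph_law /= /pushforward /= /kernel_at.
by rewrite xsectionE.
Qed.

(** By hypothesis [mu] and its bind along [graph_law] agree on rectangles, hence everywhere; the
    integral against a bind is an iterated integral. *)
Lemma integral_disintegration (mu : probability (T1 * T2)%type R) :
  (forall U V, measurable U -> measurable V ->
    mu (U `*` V) = (\int[mu]_(z in U `*` setT) k z.1 V)%E) ->
  forall f : T1 * T2 -> \bar R, measurable_fun setT f -> (forall z, 0 <= f z)%E ->
  (\int[mu]_z f z = \int[mu]_z \int[k z.1]_y f (z.1, y))%E.
Proof.
move=> dis f mf f0.
have E B : measurable B -> mu B = giry_bind (mu : giry _ R) measurable_graph_law B.
  apply: measure_eq_on_rectangles; first by rewrite -ge0_fin_numE//; exact: (fin_num_measure mu).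
  move=> U V mU mV; apply: (eq_trans (dis _ _ mU mV)).
  rewrite /giry_bind /= /giry_int ge0_integral_pushforward//=; last 2 first.
    exact: measurable_graph_law.
    exact: measurable_giry_ev (measurableX mU mV).
  rewrite integral_mkcond; apply: eq_integral => z _.
  rewrite /giry_ev /= /pushforward /kernel_at /patch.
  case: ifPn => [|].
    by move=> /set_mem[/= zU _]; congr (k _ _); apply/seteqP; split => y //= [].
  rewrite notin_setE => zU; apply/esym; rewrite (_ : _ @^-1` _ = set0) ?measure0//.
  by apply/seteqP; split => // y [/= ? ?]; exact: zU.
rewrite (@eq_measure_integral _ _ _ _ (giry_bind (mu : giry _ R) measurable_graph_law)).
  rewrite [LHS](giry_int_bind _ _ mf f0); apply: eq_integral => z _.
  rewrite /giry_int /graph_law [LHS]giry_int_map//.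
by move=> B mB _; exact: E.
Qed.

End kernel_disintegration.

(** Induction on the number of samples: the first sample is joined to [Y] and its factor is absorbed
    into the weight, which is why [w] and the type of [Y] are general. The pair [(X_0, Y)] has law
    [mu \x nu] and is independent of the remaining samples. *)
Lemma expectation_prod_le (R : realType) (n : nat) :
  forall (dO dT dZ : measure_display) (Om : measurableType dO)
    (T : measurableType dT) (Z : measurableType dZ) (Pr : probability Om R)
    (nu : probability T R) (mu : probability Z R) (Y : Om -> T)
    (X : 'I_n -> Om -> Z),
  measurable_fun setT Y -> (forall i, measurable_fun setT (X i)) ->
  (forall V U, measurable V -> (forall i, measurable (U i)) ->
    Pr [set o | V (Y o) /\ forall i, U i (X i o)] = nu V * \prod_i mu (U i))%E ->
  forall (w : T -> R) (phi : Z * T -> R), measurable_fun setT w ->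
    measurable_fun setT phi -> (forall y, 0 <= w y) -> (forall z, 0 <= phi z) ->
  (forall y, \int[mu]_z (phi (z, y))%:E <= 1)%E ->
  (\int[Pr]_o (w (Y o) * \prod_i phi (X i o, Y o))%:E <= \int[nu]_y (w y)%:E)%E.
Proof.
elim: n => [|n IHn] dO dT dZ Om T Z Pr nu mu Y X mY mX ind w phi mw mphi w0 phi0 phi1.
  under eq_integral do rewrite big_ord0 mulr1.
  rewrite -(@ge0_integral_pushforward _ _ _ _ _ _ mY Pr setT (fun y => (w y)%:E))//; last 2 first.
    exact/measurable_EFinP.
    by move=> y _; rewrite lee_fin.
  rewrite (@eq_measure_integral _ _ _ _ nu)// => V mV _.
  rewrite /= /pushforward -[RHS]mule1.
  have := ind V (fun=> setT) mV (fun=> measurableT); rewrite big_ord0 => <-.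
  by congr (Pr _); apply/seteqP; split => o /=; [split|case].
pose Y' o := (X ord0 o, Y o).
pose phi' (z : Z * (Z * T)) := phi (z.1, z.2.2).
pose w' (y : Z * T) := w y.2 * phi y.
have mY' : measurable_fun setT Y' by apply: measurable_fun_pair.
have mphi' : measurable_fun setT phi'.
  apply: measurableT_comp => //; apply: measurable_fun_pair => //.
  exact: measurableT_comp.
have mw' : measurable_fun setT w' by apply: measurable_funM => //; apply: measurableT_comp mw _; exact: measurable_snd.
(* The peeled sample is integrated first: at fixed [y] its factor has mean at most one, and only
   [w y] is left. *)
apply: (@le_trans _ _ (\int[(mu \x nu)%E]_y (w' y)%:E)%E); last first.
- rewrite fubini_tonelli2//; last 2 first.
    by apply/measurable_EFinP.
    by move=> y; rewrite lee_fin mulr_ge0.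
  rewrite /fubini_G; apply: ge0_le_integral => //.
  + by move=> y _; apply: integral_ge0 => z _; rewrite lee_fin mulr_ge0.
  + by apply: (measurable_fun_fubini_tonelli_G (m1 := mu) (fun y : Z * T => (w' y)%:E)) => //; [exact/measurable_EFinP|move=> y; rewrite lee_fin mulr_ge0].
  + exact/measurable_EFinP.
  + move=> y _ /=.
    rewrite (_ : \int[mu]_x _ = \int[mu]_x ((w y)%:E * (phi (x, y))%:E))%E//.
    rewrite (ge0_integralZl mu measurableT (f := fun z => (phi (z, y))%:E)); last 3 first.
    * by apply/measurable_EFinP; exact: measurableT_comp.
    * by move=> z _; rewrite lee_fin.
    * by rewrite lee_fin.
    by rewrite -[leRHS]mule1 lee_wpmul2l// lee_fin.
have -> : (\int[Pr]_o (w (Y o) * \prod_i phi (X i o, Y o))%:E =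
    \int[Pr]_o (w' (Y' o) * \prod_i phi' (X (lift ord0 i) o, Y' o))%:E)%E.
  by apply: eq_integral => o _; rewrite big_ord_recl mulrA.
apply: (IHn _ _ _ Om (Z * T)%type Z Pr (mu \x nu)%E mu Y'
  (fun i => X (lift ord0 i))) => //; last 3 first.
- by move=> y; exact: mulr_ge0.
- by move=> z; exact: phi0.
- by move=> y; exact: phi1.
move=> V U mV mU.
pose E := [set o | forall i, U i (X (lift ord0 i) o)].
have mE : measurable E.
  rewrite (_ : E = \bigcap_(i in setT) ((X (lift ord0 i)) @^-1` (U i))).
    apply: fin_bigcap_measurable => // i _.
    by rewrite -[X in measurable X]setTI; exact: mX.
  by apply/seteqP; split => o Eo i *; exact: Eo.
have mPY : measurable_fun setT (Y' : Om -> (Z * T)%type) by [].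
pose c := (\prod_i mu (U i))%E.
have c0 : (0 <= c)%E by apply: prode_ge0.
have cfin : c \is a fin_num by apply: prode_fin_num => i _; exact: fin_num_measure.
(* Independence of the joined pair is needed on every measurable [V], not only on rectangles. So the
   law of the pair on the event [E] is compared, as a measure, with the product law scaled by
   [c]. *)
pose m1 := pushforward (mrestr Pr mE) Y'.
pose m2 := mscale (NngNum (fine_ge0 c0)) (mu \x nu)%E.
suff : m1 V = m2 V.
  rewrite /m1 /m2 /mscale /pushforward /= fineK// muleC => <-.
  by congr (Pr _); apply/seteqP.
apply: measure_eq_on_rectangles => //.
  rewrite /= /pushforward /mrestr -ge0_fin_numE//.
  by apply: fin_num_measure; rewrite preimage_setT setTI.
move=> A B mA mB; rewrite /= /pushforward /mrestr /mscale /= fineK//.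
rewrite product_measure1E// muleCA muleA muleC.
pose U' i := oapp U A (unlift ord0 i).
have := ind B U' mB.
rewrite big_ord_recl /U' unlift_none /=.
under eq_bigr do rewrite liftK /=.
rewrite -/c => <-; last by move=> i; case: unliftP => [j|] _ /=.
congr (Pr _); apply/seteqP; split => o /=.
  move=> [[Ao Bo] Eo]; split => // i.
  by case: unliftP => [j ->|->] //; exact: Eo.
move=> [Bo Uo]; split => [|i].
  by split => //; have := Uo ord0; rewrite unlift_none.
by have := Uo (lift ord0 i); rewrite liftK.
Qed.

(** * Exponential moments of bounded variables *)

Lemma expR_le_quadratic (R : realType) (t : R) :
  t <= 1 / 4 -> expR t <= 1 + t + t ^+ 2.
Proof.
move=> t4; have inv_bound (s : R) : 0 < 1 - s -> expR s <= (1 - s)^-1.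
  move=> s1; rewrite -[s in expR s]opprK expRN lef_pV2 ?posrE ?expR_gt0//.
  exact: expR_ge1Dx.
have inv_le (s z : R) : 0 < 1 - s -> 1 <= z * (1 - s) -> (1 - s)^-1 <= z.
  by move=> s1 zs; rewrite -[leLHS]mul1r ler_pdivrMr.
have [t0|t0] := leP t 0.
  have t1 : 0 < 1 - t by lra.
  apply: (le_trans (inv_bound t t1)); apply: inv_le => //.
  suff : 0 <= - t * t ^+ 2 by nra.
  by rewrite mulr_ge0 ?sqr_ge0// oppr_ge0.
(* For positive [t] the bound [1 / (1 - t)] is too weak, since
   [(1 + t + t^2) (1 - t) = 1 - t^3 < 1]. Applied to [t / 2] and squared, it suffices up to
   [1/4]. *)
pose s := t / 2; have ts : t = s + s by rewrite /s; field.
have [s0 s8] : 0 < s /\ s <= 1 / 8 by rewrite /s; split; lra.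
have s1 : 0 < 1 - s by lra.
rewrite ts expRD -expr2.
have {inv_bound} := inv_bound _ s1; have := expR_gt0 s; move: (expR s) => e e0 es.
have {}es : (e * (1 - s)) ^+ 2 <= 1.
  rewrite expr_le1//; last by rewrite mulr_ge0// ltW.
  by rewrite -ler_pdivlMr// div1r.
rewrite -(ler_pM2r (exprn_gt0 2 s1)) -exprMn (le_trans es)//.
have -> : (1 + (s + s) + (s + s) ^+ 2) * (1 - s) ^+ 2 =
  1 + s ^+ 2 * (1 - 6 * s + 4 * s ^+ 2) by ring.
by rewrite lerDl mulr_ge0 ?sqr_ge0//; nra.
Qed.

Lemma probability_bounded_integrable (R : realType) (d : measure_display)
    (T : measurableType d) (mu : {measure set T -> \bar R}) (f : T -> R) (c : R) :
  mu setT = 1%E ->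
  measurable_fun setT f -> (forall x, `|f x| <= c) ->
  mu.-integrable setT (EFin \o f).
Proof.
move=> mu1 mf fc; apply: measurable_bounded_integrable => //.
  by rewrite mu1 ltry.
exists c; split; first exact: num_real.
by move=> M cM x _; apply: le_trans (fc x) (ltW cM).
Qed.

Lemma integral_EFin_Rintegral (R : realType) (d : measure_display)
    (T : measurableType d) (mu : {measure set T -> \bar R}) (f : T -> R) :
  mu.-integrable setT (EFin \o f) ->
  (\int[mu]_x (f x)%:E = (\int[mu]_x f x)%R%:E)%E.
Proof. by move=> fi; rewrite /Rintegral fineK//; exact: integrable_fin_num. Qed.

Lemma Rintegral_cst1 (R : realType) (d : measure_display)
    (T : measurableType d) (mu : {measure set T -> \bar R}) (c : R) :
  mu setT = 1%E -> \int[mu]_x c = c.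
Proof. by move=> mu1; rewrite Rintegral_cst// mu1 mulr1. Qed.

(** With [a] the mean, [E exp Y <= 1 + E Y + E Y^2 <= 1 + a + b <= exp (a + b)], the first step
    being [expR_le_quadratic]. *)
Lemma mgf_le1 (R : realType) (d : measure_display)
    (T : measurableType d) (mu : {measure set T -> \bar R}) (Y : T -> R) (b : R) :
  mu setT = 1%E ->
  measurable_fun setT Y -> (forall x, -1 <= Y x <= 1 / 4) ->
  \int[mu]_x (Y x ^+ 2) <= b ->
  (\int[mu]_x (expR (Y x - (\int[mu]_x (Y x) + b)))%:E <= 1)%E.
Proof.
move=> mu1 mY Yb Y2; set a := \int[mu]_x (Y x).
have {}Yb x : -1 <= Y x /\ Y x <= 1 / 4 by apply/andP.
have iY : mu.-integrable setT (EFin \o Y).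
  by apply: (@probability_bounded_integrable _ _ _ _ _ 1) => // x; have [] := Yb x; rewrite ler_norml => *; apply/andP; split; lra.
have iY2 : mu.-integrable setT (EFin \o (fun x => Y x ^+ 2)).
  apply: (@probability_bounded_integrable _ _ _ _ _ 1) => // [|x].
    exact: measurable_funX.
  by have [] := Yb x; rewrite ger0_norm ?sqr_ge0//; nra.
have i1 : mu.-integrable setT (EFin \o (fun x => 1 + Y x)).
  apply: (@probability_bounded_integrable _ _ _ _ _ 3) => // [|x].
    exact: measurable_funD.
  by have [] := Yb x; rewrite ler_norml => *; apply/andP; split; lra.
have mE : measurable_fun setT (fun x => expR (Y x - (a + b))).
  apply: measurableT_comp; first exact: measurable_expR.
  exact: measurable_funB.
have e_le x : expR (Y x - (a + b)) <= expR (- (a + b)) * (1 + Y x + Y x ^+ 2).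
  rewrite addrC expRD ler_wpM2l ?expR_ge0//; apply: expR_le_quadratic.
  by have [] := Yb x.
have i3 := integrableD measurableT i1 iY2.
have iU : mu.-integrable setT
    (EFin \o (fun x => expR (- (a + b)) * (1 + Y x + Y x ^+ 2))).
  exact: (integrableZl measurableT (expR (- (a + b))) i3).
apply: (@le_trans _ _ (\int[mu]_x (expR (- (a + b)) * (1 + Y x + Y x ^+ 2))%:E)%E).
  apply: ge0_le_integral => //; [|exact: measurable_int iU|].
  - exact/measurable_EFinP.
  - by move=> x _; rewrite lee_fin.
rewrite integral_EFin_Rintegral// RintegralZl//; rewrite (RintegralD _ i1)// RintegralD//; last first.
  by apply: (@probability_bounded_integrable _ _ _ _ _ 1) => // x; rewrite normr1.
rewrite Rintegral_cst1// lee_fin -/a.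
rewrite expRN mulrC ler_pdivrMr ?expR_gt0// mul1r.
apply: le_trans (expR_ge1Dx _); lra.
Qed.

(** Write [(f - y)^2 - (t - y)^2] as [(f - t)^2 + 2 (f - t) (t - y)]. The cross term has mean zero
    because [t] is the conditional mean of [y], so the mean is [q]. The same difference factors as
    [(f - t) (f + t - 2 y)] with the second factor at most 2 in modulus, so its second moment is at
    most [4 q]. After division by -8 these become [- q / 8] and [q / 16], and [mgf_le1] applies. *)
Lemma excess_mgf_le1 (R : realType) (d1 d2 : measure_display)
    (T1 : measurableType d1) (T2 : measurableType d2) (k : R.-pker T1 ~> T2)
    (mu : probability (T1 * T2)%type R) (f t : T1 -> R) (y : T2 -> R) :
  (forall U V, measurable U -> measurable V ->
    mu (U `*` V) = (\int[mu]_(z in U `*` setT) k z.1 V)%E) ->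
  measurable_fun setT f -> measurable_fun setT t -> measurable_fun setT y ->
  (forall x, 0 <= f x <= 1) -> (forall x, 0 <= t x <= 1) ->
  (forall x, 0 <= y x <= 1) -> (forall x, t x = \int[k x]_z y z) ->
  (\int[mu]_z (expR (((t z.1 - y z.2) ^+ 2 - (f z.1 - y z.2) ^+ 2) / 8 +
     (\int[mu]_z (f z.1 - t z.1) ^+ 2) / 16))%:E <= 1)%E.
Proof.
move=> dis mf mt my f01 t01 y01 ty.
have mu1 : mu setT = 1%E := probability_setT mu.
have mf1 : measurable_fun [set: T1 * T2] (fun z => f z.1) by apply: measurableT_comp.
have mt1 : measurable_fun [set: T1 * T2] (fun z => t z.1) by apply: measurableT_comp.
have my2 : measurable_fun [set: T1 * T2] (fun z => y z.2) by apply: measurableT_comp.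
set q := \int[mu]_z _.
have mq : measurable_fun [set: T1 * T2] (fun z => (f z.1 - t z.1) ^+ 2).
  by apply: measurable_funX; exact: measurable_funB.
have iq : mu.-integrable setT (EFin \o (fun z => (f z.1 - t z.1) ^+ 2)).
  apply: (@probability_bounded_integrable _ _ _ _ _ 1) => // z.
  have /andP[? ?] := f01 z.1; have /andP[? ?] := t01 z.1.
  by rewrite ger0_norm ?sqr_ge0//; nra.
pose c (z : T1 * T2) := (f z.1 - t z.1) * (t z.1 - y z.2).
have mc : measurable_fun [set: T1 * T2] c.
  by apply: measurable_funM; exact: measurable_funB.
have cb z : `|c z| <= 1.
  have /andP[? ?] := f01 z.1; have /andP[? ?] := t01 z.1; have /andP[? ?] := y01 z.2.
  by rewrite /c ler_norml; apply/andP; split; nra.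
have ic : mu.-integrable setT (EFin \o c).
  exact: (@probability_bounded_integrable _ _ _ _ _ 1).
have i1 : mu.-integrable setT (EFin \o (fun=> 1)).
  by apply: (@probability_bounded_integrable _ _ _ _ _ 1) => // z; rewrite normr1.
have c0 : \int[mu]_z c z = 0.
  (* Adding 1 makes the integrand nonnegative, as [integral_disintegration] requires; [c] is bounded
     by 1 in modulus. *)
  have /eqP : (\int[mu]_z (c z + 1)%:E = 1)%E.
    rewrite (integral_disintegration dis); last 2 first.
    - by apply/measurable_EFinP; exact: measurable_funD.
    - by move=> z; rewrite lee_fin; have := cb z; rewrite ler_norml => /andP[]; lra.
    rewrite -[RHS](probability_setT mu) -[RHS]mul1e -integral_cst//.
    apply: eq_integral => z _; rewrite /c /=.
    have k1 : k z.1 setT = 1%E by exact: prob_kernel.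
    have iy : (k z.1).-integrable setT (EFin \o y).
      apply: (@probability_bounded_integrable _ _ _ _ _ 1) => // x.
      by have /andP[? ?] := y01 x; rewrite ger0_norm.
    have icst (r : R) : (k z.1).-integrable setT (EFin \o (fun=> r)).
      exact: (@probability_bounded_integrable _ _ _ _ _ `|r|).
    have iZ (r : R) : (k z.1).-integrable setT (EFin \o (fun x => r * y x)).
      exact: (integrableZl measurableT r iy).
    have -> : (fun x => ((f z.1 - t z.1) * (t z.1 - y x) + 1)%:E) =
        (EFin \o (fun x => ((f z.1 - t z.1) * t z.1 + 1) + (t z.1 - f z.1) * y x)).
      by apply/funext => x /=; congr (_%:E); ring.
    rewrite integral_EFin_Rintegral; last exact: (integrableD measurableT (icst _) (iZ _)).
    rewrite RintegralD// Rintegral_cst1// RintegralZl// -ty; congr (_%:E); ring.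
  rewrite integral_EFin_Rintegral; last exact: (integrableD measurableT ic i1).
  by rewrite eqe RintegralD// Rintegral_cst1// => /eqP; lra.
have i2c : mu.-integrable setT (EFin \o (fun z => 2 * c z)).
  exact: (integrableZl measurableT 2 ic).
pose Y (z : T1 * T2) := ((t z.1 - y z.2) ^+ 2 - (f z.1 - y z.2) ^+ 2) / 8.
have EY : Y = (fun z => (- 1 / 8) * ((f z.1 - t z.1) ^+ 2 + 2 * c z)).
  by apply/funext => z; rewrite /Y /c; field.
have mY : measurable_fun setT Y.
  rewrite EY; apply: measurable_funM => //; apply: measurable_funD => //.
  exact: measurable_funM.
have := @mgf_le1 _ _ _ mu Y (q / 16) mu1 mY.
have -> : \int[mu]_z Y z = - q / 8.
  rewrite EY RintegralZl//; last first.
    exact: (integrableD measurableT iq i2c).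
  rewrite RintegralD// ?RintegralZl// ?c0.
  by rewrite -/q; field.
move=> H; rewrite [leLHS](eq_integral (fun z => (expR (Y z - (- q / 8 + q / 16)))%:E)); last first.
  by move=> z _; congr (expR _)%:E; rewrite /Y; field.
have Yb z : -1 <= Y z /\ Y z <= 1 / 4.
  have /andP[? ?] := f01 z.1; have /andP[? ?] := t01 z.1.
  by have /andP[? ?] := y01 z.2; rewrite /Y; split; nra.
apply: H; first by move=> z; apply/andP.
apply: (@le_trans _ _ (\int[mu]_z (1 / 16 * (f z.1 - t z.1) ^+ 2))); last first.
    by rewrite RintegralZl// -/q; lra.
  apply: le_Rintegral => //.
  + apply: (@probability_bounded_integrable _ _ _ _ _ 1) => // [|z].
      exact: measurable_funX.
    have [Yl Yu] := Yb z; rewrite ger0_norm ?sqr_ge0//; nra.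
  + exact: (integrableZl measurableT (1/16) iq).
  + move=> z _; rewrite EY /c.
    have := f01 z.1; have := t01 z.1; have := y01 z.2.
    move: (f _) (t _) (y _) => a b e /andP[? ?] /andP[? ?] /andP[? ?].
    have -> : (-1 / 8 * ((a - b) ^+ 2 + 2 * ((a - b) * (b - e)))) ^+ 2 =
      (a - b) ^+ 2 * ((a + b - 2 * e) ^+ 2 / 64) by field.
    by rewrite [leRHS]mulrC ler_wpM2l ?sqr_ge0//; nra.
Qed.

(** Since [q^2 <= q], the variable [- q / 2] has second moment at most a quarter of the mean of [q].
    This self-bounding gives a lower tail at fast rate: the empirical mean is at least half the
    mean, up to a term of order [1 / m]. *)
Lemma lower_mgf_le1 (R : realType) (d : measure_display)
    (T : measurableType d) (mu : probability T R) (q : T -> R) :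
  measurable_fun setT q -> (forall x, 0 <= q x <= 1) ->
  (\int[mu]_x (expR (- q x / 2 + (\int[mu]_x q x) / 4))%:E <= 1)%E.
Proof.
move=> mq q01; have mu1 : mu setT = 1%E := probability_setT mu.
have iq : mu.-integrable setT (EFin \o q).
  apply: (@probability_bounded_integrable _ _ _ _ _ 1) => // x.
  by have /andP[? ?] := q01 x; rewrite ger0_norm.
set e := \int[mu]_x q x.
have mY : measurable_fun setT (fun x => (- 1 / 2) * q x) by exact: measurable_funM.
have H := @mgf_le1 _ _ _ mu (fun x => (- 1 / 2) * q x) (e / 4) mu1 mY.
rewrite RintegralZl// -/e in H.
rewrite [leLHS](eq_integral (fun x => (expR ((- 1 / 2) * q x - (- 1 / 2 * e + e / 4)))%:E)); last first.
  by move=> x _; congr (expR _)%:E; field.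
apply: H => [x|]; first by have /andP[? ?] := q01 x; apply/andP; split; lra.
apply: (@le_trans _ _ (\int[mu]_x (1 / 4 * q x))); last by rewrite RintegralZl// -/e; lra.
apply: le_Rintegral => //.
- apply: (@probability_bounded_integrable _ _ _ _ _ 1) => // [|x].
    exact: measurable_funX.
  by have /andP[? ?] := q01 x; rewrite ger0_norm ?sqr_ge0//; nra.
- exact: (integrableZl measurableT (1 / 4) iq).
- by move=> x _; have /andP[? ?] := q01 x; nra.
Qed.

(** Jensen's inequality from the tangent of the exponential at the mean [b]: the linear terms
    [a j - b] sum to zero. *)
Lemma expR_mean_le (R : realType) (m : nat) (a : 'I_m -> R) : (0 < m)%N ->
  expR (m%:R^-1 * \sum_j a j) <= m%:R^-1 * \sum_j expR (a j).
Proof.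
move=> m0; have mR : 0 < m%:R :> R by rewrite ltr0n.
set b := m%:R^-1 * _.
have bE : \sum_j a j = m%:R * b by rewrite /b mulVKf// gt_eqF.
rewrite -(ler_pM2l mR) mulVKf ?gt_eqF//.
rewrite (_ : m%:R * expR b = \sum_j expR b * (1 + (a j - b))); last first.
  rewrite -mulr_sumr big_split/= sumrB bE !sumr_const card_ord.
  by rewrite -(mulr_natl b) subrr addr0 mulrC.
apply: ler_sum => j _; rewrite -[in leRHS](subrK b (a j)) [in leRHS]addrC expRD.
by rewrite ler_wpM2l ?expR_ge0// expR_ge1Dx.
Qed.

Lemma markov_event (R : realType) (d : measure_display) (Om : measurableType d)
    (Pr : probability Om R) (W : Om -> R) (delta : R) :
  measurable_fun setT W -> (forall o, 0 <= W o) ->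
  (\int[Pr]_o (W o)%:E <= delta%:E)%E ->
  measurable [set o | W o < 1] /\ ((1 - delta)%:E <= Pr [set o | (W o < 1)%R])%E.
Proof.
move=> mW W0 EW.
have mE : measurable [set o | W o < 1].
  rewrite (_ : [set o | W o < 1] = setT `&` W @^-1` `]-oo, 1[%classic).
    by apply: mW => //; exact: measurable_itv.
  by rewrite setTI; apply/seteqP; split => o /=; rewrite in_itv.
split => //.
have -> : [set o | W o < 1] = ~` [set o | 1 <= W o].
  by apply/seteqP; split => o /=; [move=> ?; apply/negP; rewrite -ltNge|move/negP; rewrite -ltNge].
have mF : measurable [set o | 1 <= W o].
  rewrite [X in measurable X](_ : _ = ~` [set o | W o < 1]); first exact: measurableC.
  by apply/seteqP; split => o /=; [move=> ?; apply/negP; rewrite -leNgt|move/negP; rewrite -leNgt].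
rewrite probability_setC// EFinB leeB//.
apply: le_trans EW; rewrite -(setIT [set o | 1 <= W o]) -integral_indic//.
apply: ge0_le_integral => //.
- by apply/measurable_EFinP; exact: measurable_indic.
- exact/measurable_EFinP.
- move=> o _; rewrite lee_fin indicE; case: (boolP (o \in _)) => [|_]; last exact: W0.
  by rewrite inE.
Qed.

(** * Concentration over all pairs of samples *)

Section nonneg_expectation.
Context {R : realType} {d : measure_display} {T : measurableType d}
  (mu : {measure set T -> \bar R}).

(** Bundled so that the random variable [W] of [concentration_event] can be bounded term by term. *)
Definition mean_le (f : T -> R) (c : R) : Prop :=
  [/\ measurable_fun setT f, (forall x, 0 <= f x) &
      (\int[mu]_x (f x)%:E <= c%:E)%E].

Lemma mean_le_add f g a b :
  mean_le f a -> mean_le g b -> mean_le (fun x => f x + g x) (a + b).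
Proof.
move=> [mf f0 fa] [mg g0 gb]; split; first exact: measurable_funD.
  by move=> x; rewrite addr_ge0.
under eq_integral do rewrite EFinD.
rewrite ge0_integralD//; last 4 first.
- by move=> x _; rewrite lee_fin.
- exact/measurable_EFinP.
- by move=> x _; rewrite lee_fin.
- exact/measurable_EFinP.
by rewrite EFinD leeD.
Qed.

Lemma mean_le_scale f a c : 0 <= c ->
  mean_le f a -> mean_le (fun x => c * f x) (c * a).
Proof.
move=> c0 [mf f0 fa]; split; first exact: measurable_funM.
  by move=> x; rewrite mulr_ge0.
under eq_integral do rewrite EFinM.
rewrite (ge0_integralZl _ measurableT (f := EFin \o f)); last 3 first.
- exact/measurable_EFinP.
- by move=> x _; rewrite lee_fin.
- by rewrite lee_fin.
by rewrite EFinM lee_wpmul2l// lee_fin.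
Qed.

Lemma mean_le_sum (I : Type) (s : seq I) (f : I -> T -> R) (a : I -> R) :
  (forall i, mean_le (f i) (a i)) ->
  mean_le (fun x => \sum_(i <- s) f i x) (\sum_(i <- s) a i).
Proof.
move=> fa; elim: s => [|i s IHs].
  rewrite big_nil; split.
  - by under eq_fun do rewrite big_nil; exact: measurable_cst.
  - by move=> x; rewrite big_nil.
  - by under eq_integral do rewrite big_nil; rewrite integral0.
have [mf f0 fi] := mean_le_add (fa i) IHs.
rewrite big_cons; split.
- by under eq_fun do rewrite big_cons.
- by move=> x; rewrite big_cons.
- by under eq_integral do rewrite big_cons.
Qed.

End nonneg_expectation.

Section concentration.
Context {R : realType} {dS dA dC dO : measure_display} {S : measurableType dS}
  {A : measurableType dA} {C : measurableType dC} {Om : measurableType dO}.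
Local Notation Z := (S * A * S)%type.
Local Notation X := (S * C)%type.
Variables (mu_dyn : probability Z R) (mu_goal : probability X R)
  (Pr : probability Om R) (n m : nat)
  (Ddyn : 'I_n -> Om -> Z) (Dgoal : 'I_m -> Om -> X).
Hypotheses (n0 : (0 < n)%N) (m0 : (0 < m)%N)
  (iid : iid_samples mu_dyn mu_goal Pr Ddyn Dgoal).

(** The goal sample [j] takes the part of [Y] in [expectation_prod_le]; the other goal samples are
    marginalised by choosing the full set for them. *)
Lemma expectation_prod_dyn_le1 (j : 'I_m) (phi : Z * X -> R) :
  measurable_fun setT phi -> (forall z, 0 <= phi z) ->
  (forall x, \int[mu_dyn]_z (phi (z, x))%:E <= 1)%E ->
  (\int[Pr]_o (\prod_i phi (Ddyn i o, Dgoal j o))%:E <= 1)%E.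
Proof.
move=> mphi phi0 phi1; have [mD mG ind] := iid.
have := @expectation_prod_le R n _ _ _ Om X Z Pr mu_goal mu_dyn (Dgoal j) Ddyn
  (mG j) mD _ (fun=> 1) phi (measurable_cst _) mphi (fun=> ler01) phi0 phi1.
rewrite (_ : (\int[mu_goal]_y 1%:E)%E = 1%E); last first.
  by rewrite integral_cst// mul1e; exact: probability_setT.
under eq_integral do rewrite mul1r.
apply => V U mV mU.
have := ind U (fun j' => if j' == j then V else setT) mU.
rewrite [X in (_ * X)%E](bigD1 j)//= eqxx [X in (_ * (_ * X))%E]big1 ?mule1; last first.
  by move=> i /negbTE ->; exact: probability_setT.
rewrite muleC => <-; last by move=> j'; case: ifP.
congr (Pr _); apply/seteqP; split => o /=.
  by move=> [Vo Uo]; split => // j'; case: eqP => // ->.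
by move=> [Uo Vo]; split => //; have := Vo j; rewrite eqxx.
Qed.

(** The dynamics sample [i0], which exists because [0 < n], fills the slot of [Y]; the integrand is
    constant in it. *)
Lemma expectation_prod_goal_le1 (psi : X -> R) :
  measurable_fun setT psi -> (forall x, 0 <= psi x) ->
  (\int[mu_goal]_x (psi x)%:E <= 1)%E ->
  (\int[Pr]_o (\prod_j psi (Dgoal j o))%:E <= 1)%E.
Proof.
move=> mpsi psi0 psi1; have [mD mG ind] := iid.
have i0 : 'I_n := Ordinal n0.
have mphi : measurable_fun [set: X * Z] (fun z => psi z.1) by apply: measurableT_comp.
have := @expectation_prod_le R m _ _ _ Om Z X Pr mu_dyn mu_goal (Ddyn i0) Dgoal
  (mD i0) mG _ (fun=> 1) (fun z => psi z.1) (measurable_cst _) mphi (fun=> ler01)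
  (fun z => psi0 z.1) (fun=> psi1).
rewrite (_ : (\int[mu_dyn]_y 1%:E)%E = 1%E); last first.
  by rewrite integral_cst// mul1e; exact: probability_setT.
under eq_integral do rewrite mul1r.
apply => V U mV mU.
have := ind (fun i => if i == i0 then V else setT) U _ mU.
rewrite [X in (X * _)%E](bigD1 i0)//= eqxx [X in (_ * X * _)%E]big1 ?mule1; last first.
  by move=> i /negbTE ->; exact: probability_setT.
move=> <-; last by move=> j'; case: ifP.
congr (Pr _); apply/seteqP; split => o /=.
  by move=> [Vo Uo]; split => // j'; case: eqP => // ->.
by move=> [Vo Uo]; split => //; have := Vo i0; rewrite eqxx.
Qed.

Lemma sample_in_full_set (G0 : set X) (j : 'I_m) :
  measurable G0 -> mu_goal (~` G0) = 0%E ->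
  (\int[Pr]_o (\1_(~` G0) (Dgoal j o))%:E = 0)%E.
Proof.
move=> mG0 G00; have [mD mG ind] := iid.
have mN : measurable (~` G0) by exact: measurableC.
have mP : measurable (Dgoal j @^-1` (~` G0)).
  by rewrite -[X in measurable X]setTI; exact: mG.
transitivity (\int[Pr]_o (\1_(Dgoal j @^-1` (~` G0)) o)%:E)%E => //.
rewrite integral_indic// setIT.
have := ind (fun=> setT) (fun j' => if j' == j then ~` G0 else setT) (fun=> measurableT).
rewrite [X in (_ * X)%E](bigD1 j)//= eqxx G00 mul0e mule0 => <-; last first.
  by move=> j'; case: ifP.
congr (Pr _); apply/seteqP; split => o /=.
  by move=> Vo; split => // j'; case: eqP => // ->.
by move=> [_ Vo]; have := Vo j; rewrite eqxx.
Qed.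

Lemma measurable_sample_prod (j : 'I_m) (phi : Z * X -> R) :
  measurable_fun setT phi ->
  measurable_fun setT (fun o => \prod_i phi (Ddyn i o, Dgoal j o)).
Proof.
move=> mphi; have [mD mG _] := iid.
by apply: measurable_prod => i _; apply: measurableT_comp => //; apply: measurable_fun_pair.
Qed.

(** [W] adds up all exponential moments, weighted so that the terms [W1], [W2 (q i)] and [W2 (g j)]
    contribute [delta / 3] each. [W3] counts the goal samples outside [G0] and has mean 0. On
    [W < 1] every exponential is below the reciprocal of its weight, which is the argument of [LI]
    or [LJ], and [W3], a count, must be zero. *)
Lemma concentration_event (I J : finType) (h : I -> Z * X -> R) (q : I -> X -> R)
    (g : J -> X -> R) (G0 : set X) (delta : R) :
  (0 < #|I|)%N -> (0 < #|J|)%N -> 0 < delta ->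
  (forall i, measurable_fun setT (h i)) -> (forall i, measurable_fun setT (q i)) ->
  (forall i x, 0 <= q i x <= 1) ->
  (forall i x, \int[mu_dyn]_z (expR (- h i (z, x) / 8 + q i x / 16))%:E <= 1)%E ->
  (forall j, measurable_fun setT (g j)) -> (forall j x, 0 <= g j x <= 1) ->
  measurable G0 -> mu_goal (~` G0) = 0%E ->
  exists E : set Om, [/\ measurable E, ((1 - delta)%:E <= Pr E)%E &
    forall o, E o ->
    let LI := ln (3 * #|I|%:R / delta) in let LJ := ln (3 * #|J|%:R / delta) in
    [/\ forall i, (\int[mu_goal]_x q i x) / 4 - LI / m%:R - 8 * (LI / n%:R) <=
          (n%:R * m%:R)^-1 * \sum_k \sum_j h i (Ddyn k o, Dgoal j o),
        forall j, (\int[mu_goal]_x g j x) / 2 - 2 * (LJ / m%:R) <=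
          m%:R^-1 * \sum_l g j (Dgoal l o) &
        forall l, G0 (Dgoal l o)]].
Proof.
move=> I0 J0 d0 mh mq q01 hq mg g01 mG0 G00.
have [mD mG ind] := iid.
pose phi i (zx : Z * X) := expR (- h i zx / 8 + q i zx.2 / 16).
pose psi (f : X -> R) x := expR (- f x / 2 + (\int[mu_goal]_x f x) / 4).
pose W1 i o := m%:R^-1 * \sum_j \prod_k phi i (Ddyn k o, Dgoal j o).
pose W2 f o := \prod_(l < m) psi f (Dgoal l o).
pose W3 o := \sum_(l < m) \1_(~` G0) (Dgoal l o) : R.
pose cI := delta / (3 * #|I|%:R); pose cJ := delta / (3 * #|J|%:R).
pose W o := cI * \sum_i (W1 i o + W2 (q i) o) + cJ * \sum_j W2 (g j) o + W3 o.
have cI0 : 0 < cI by rewrite divr_gt0// mulr_gt0// ltr0n.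
have cJ0 : 0 < cJ by rewrite divr_gt0// mulr_gt0// ltr0n.
have W1le i : mean_le Pr (W1 i) 1.
  have mphi : measurable_fun setT (phi i).
    apply: measurableT_comp; first exact: measurable_expR.
    apply: measurable_funD; apply: measurable_funM => //.
      by apply: measurableT_comp => //; exact: measurable_funN.
    exact: measurableT_comp.
  have -> : 1 = m%:R^-1 * \sum_(j < m) 1 :> R.
    by rewrite sumr_const card_ord mulVf// pnatr_eq0 -lt0n.
  apply: mean_le_scale; first by rewrite invr_ge0.
  apply: mean_le_sum => j; split.
  - exact: measurable_sample_prod.
  - by move=> o; apply: prodr_ge0 => k _; exact: expR_ge0.
  - apply: expectation_prod_dyn_le1 => // [z|x]; first exact: expR_ge0.
    exact: hq.
have W2le (f : X -> R) : measurable_fun setT f -> (forall x, 0 <= f x <= 1) ->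
    mean_le Pr (W2 f) 1.
  move=> mf f01; have mpsi : measurable_fun setT (psi f).
    apply: measurableT_comp; first exact: measurable_expR.
    apply: measurable_funD => //; apply: measurable_funM => //.
    exact: measurable_funN.
  split.
  - by apply: measurable_prod => l _; exact: measurableT_comp.
  - by move=> o; apply: prodr_ge0 => k _; exact: expR_ge0.
  - apply: expectation_prod_goal_le1 => // [x|]; first exact: expR_ge0.
    exact: lower_mgf_le1.
have mG0C : measurable (~` G0) by exact: measurableC.
have W3le : mean_le Pr W3 0.
  have -> : 0 = \sum_(j < m) 0 :> R by rewrite big1.
  apply: mean_le_sum => l; split.
  - by apply: measurableT_comp => //; exact: measurable_indic.
  - by move=> o; rewrite indicE.
  - by rewrite sample_in_full_set.
have [mW W0 Wd] : mean_le Pr W delta.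
  have -> : delta = cI * (\sum_(i : I) (1 + 1)) + cJ * (\sum_(j : J) 1) + 0.
    have I0R : #|I|%:R != 0 :> R by rewrite pnatr_eq0 -lt0n.
    have J0R : #|J|%:R != 0 :> R by rewrite pnatr_eq0 -lt0n.
    rewrite !sumr_const -mulr_natl -(mulr_natl 1 #|J|) /cI /cJ.
    by field; rewrite I0R J0R.
  apply: mean_le_add => //; apply: mean_le_add.
    apply: mean_le_scale; first exact: ltW.
    by apply: mean_le_sum => i; apply: mean_le_add => //; exact: W2le.
  apply: mean_le_scale; first exact: ltW.
  by apply: mean_le_sum => j; exact: W2le.
have [mE PE] := markov_event mW W0 Wd.
exists [set o | W o < 1]; split; [exact: mE|exact: PE|move=> o Wo LI LJ].
have {}Wo : W o < 1 := Wo.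
have [W10 W20 W2g0 W30] : [/\ forall i, 0 <= W1 i o, forall i, 0 <= W2 (q i) o,
    forall j, 0 <= W2 (g j) o & 0 <= W3 o].
  split => [i|i|j|]; first by have [] := W1le i.
  - by have [] := W2le _ (mq i) (q01 i).
  - by have [] := W2le _ (mg j) (g01 j).
  - by have [] := W3le.
have SI0 : 0 <= cI * \sum_i (W1 i o + W2 (q i) o).
  by apply: mulr_ge0; [exact: ltW|apply: sumr_ge0 => i _; exact: addr_ge0].
have SJ0 : 0 <= cJ * \sum_j W2 (g j) o.
  by apply: mulr_ge0; [exact: ltW|apply: sumr_ge0].
have expR_lt_ln (x y : R) : 0 < y -> expR x < y -> x < ln y.
  by move=> y0 xy; rewrite -ltr_expR lnK// posrE.
have WI i : W1 i o + W2 (q i) o < cI^-1.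
  rewrite -(ltr_pM2l cI0) mulfV ?gt_eqF//; apply: le_lt_trans Wo.
  rewrite /W -addrA ler_wpDr ?addr_ge0// ler_pM2l// (bigD1 i)//= ler_wpDr//.
  by apply: sumr_ge0 => i' _; rewrite addr_ge0.
have WJ j : W2 (g j) o < cJ^-1.
  rewrite -(ltr_pM2l cJ0) mulfV ?gt_eqF//; apply: le_lt_trans Wo.
  rewrite /W addrAC ler_wpDl ?addr_ge0// ler_pM2l// (bigD1 j)//= ler_wpDr//.
  exact: sumr_ge0.
have {}WI i : W1 i o < 3 * #|I|%:R / delta /\ W2 (q i) o < 3 * #|I|%:R / delta.
  by rewrite -(invf_div delta) -/cI; have := WI i; have := W10 i; have := W20 i; split; lra.
have {}WJ j : W2 (g j) o < 3 * #|J|%:R / delta.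
  by rewrite -(invf_div delta).
have I1 : 0 < 3 * #|I|%:R / delta by rewrite divr_gt0// mulr_gt0// ltr0n.
have J1 : 0 < 3 * #|J|%:R / delta by rewrite divr_gt0// mulr_gt0// ltr0n.
have nR : 0 < n%:R :> R by rewrite ltr0n.
have mR : 0 < m%:R :> R by rewrite ltr0n.
have lower (f : X -> R) y : 0 < y -> W2 f o < y ->
    (\int[mu_goal]_x f x) / 2 - 2 * (ln y / m%:R) <=
    m%:R^-1 * \sum_l f (Dgoal l o).
  move=> y0; rewrite /W2 /psi -expR_sum => /(expR_lt_ln _ _ y0).
  set e := \int[mu_goal]_x f x; set b := m%:R^-1 * _.
  have -> : \sum_(l < m) (- f (Dgoal l o) / 2 + e / 4) = (- b / 2 + e / 4) * m%:R.
    rewrite big_split/= sumr_const card_ord -mulr_natr -mulr_suml sumrN.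
    by rewrite (_ : \sum_l f (Dgoal l o) = b * m%:R); [ring|rewrite /b mulrAC mulVf ?mul1r// gt_eqF].
  by rewrite -ltr_pdivlMr//; set p := ln y / _; lra.
split.
(* With [a] the average of [h i] over pairs and [b] that of [q i] over goal samples, [W1] gives
   [a > b / 2 - 8 LI / n] and [W2] gives [b >= e / 2 - 2 LI / m]; together they produce the
   constants 1/4, 1 and 8. *)
- move=> i; have [WI1 WI2] := WI i.
  have := lower _ _ I1 WI2; rewrite -/LI.
  have : expR (m%:R^-1 * \sum_j \sum_k (- h i (Ddyn k o, Dgoal j o) / 8 +
      q i (Dgoal j o) / 16)) < 3 * #|I|%:R / delta.
    apply: le_lt_trans WI1; rewrite /W1 /phi.
    apply: (le_trans (expR_mean_le _ m0)); rewrite ler_pM2l ?invr_gt0//.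
    by apply: ler_sum => j _; rewrite expR_sum.
  move=> /(expR_lt_ln _ _ I1); rewrite -/LI.
  set b := m%:R^-1 * \sum_l q i _; set a := (n%:R * m%:R)^-1 * _.
  set e := \int[mu_goal]_x q i x.
  have -> : m%:R^-1 * (\sum_(j < m) \sum_(k < n) (- h i (Ddyn k o, Dgoal j o) / 8 +
      q i (Dgoal j o) / 16)) = (- a / 8 + b / 16) * n%:R.
    have -> : \sum_(j < m) \sum_(k < n) (- h i (Ddyn k o, Dgoal j o) / 8 +
        q i (Dgoal j o) / 16) =
        - (\sum_k \sum_j h i (Ddyn k o, Dgoal j o)) / 8 +
        n%:R * (\sum_j q i (Dgoal j o)) / 16.
      rewrite exchange_big [in RHS]exchange_big /= -sumrN.
      rewrite mulr_sumr !mulr_suml -big_split/=.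
      rewrite exchange_big; apply: eq_bigr => j _.
      rewrite big_split/= -mulr_suml sumrN sumr_const card_ord -mulr_natl.
      by congr (_ + _); ring.
    by rewrite /a /b; field; rewrite !gt_eqF.
  rewrite -ltr_pdivlMr//; set p := LI / n%:R; set r := LI / m%:R; lra.
- move=> j; exact: lower.
- move=> l; apply: contrapT => Gl.
  have : 1 <= W3 o.
    by rewrite /W3 (bigD1 l)//= indicE mem_set// lerDl sumr_ge0// => i _; rewrite indicE.
  move: Wo; rewrite /W; lra.
Qed.
End concentration.

(** * Positive operators and their resolvents *)

Section positive_operators.
Context {R : realType}.
Local Open Scope ereal_scope.

Definition nonneg_measurable (d : measure_display) (T : measurableType d)
    (w : T -> \bar R) : Prop :=
  measurable_fun setT w /\ forall x, 0 <= w x.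

(* The functional analogue of a kernel: what integration against a transition
   kernel shares with its iterates and their sums. *)
Record positive_operator (d1 d2 : measure_display) (T1 : measurableType d1)
    (T2 : measurableType d2) (L : (T1 -> \bar R) -> T2 -> \bar R) : Prop := {
  posop_nonneg : forall w, nonneg_measurable w -> nonneg_measurable (L w) ;
  posop_le : forall v w, nonneg_measurable v -> nonneg_measurable w ->
    (forall x, v x <= w x) -> forall z, L v z <= L w z ;
  posop_add : forall v w, nonneg_measurable v -> nonneg_measurable w ->
    forall z, L (fun x => v x + w x) z = L v z + L w z ;
  posop_scale : forall (c : R) w, (0 <= c)%R -> nonneg_measurable w ->
    forall z, L (fun x => c%:E * w x) z = c%:E * L w z ;
  posop_series : forall u : nat -> T1 -> \bar R,
    (forall n, nonneg_measurable (u n)) ->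
    forall z, L (fun x => \sum_(n <oo) u n x) z = \sum_(n <oo) L (u n) z }.

Lemma nonneg_measurable_add d (T : measurableType d) (v w : T -> \bar R) :
  nonneg_measurable v -> nonneg_measurable w ->
  nonneg_measurable (fun x => v x + w x).
Proof.
move=> [mv v0] [mw w0]; split; first exact: emeasurable_funD.
by move=> x; rewrite adde_ge0.
Qed.

Lemma nonneg_measurable_scale d (T : measurableType d) (c : R) (w : T -> \bar R) :
  (0 <= c)%R -> nonneg_measurable w -> nonneg_measurable (fun x => c%:E * w x).
Proof.
move=> c0 [mw w0]; split; first exact: measurable_funeM.
by move=> x; rewrite mule_ge0// lee_fin.
Qed.

Lemma nonneg_measurable_sum d (T : measurableType d) (u : nat -> T -> \bar R) n :
  (forall k, nonneg_measurable (u k)) ->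
  nonneg_measurable (fun x => \sum_(k < n) u k x).
Proof.
move=> mu; split; first by apply: emeasurable_sum => k; case: (mu k).
by move=> x; apply: sume_ge0 => k _; case: (mu k).
Qed.

Lemma nonneg_measurable_series d (T : measurableType d) (u : nat -> T -> \bar R) :
  (forall n, nonneg_measurable (u n)) ->
  nonneg_measurable (fun x => \sum_(n <oo) u n x).
Proof.
move=> mu; split.
  by apply: ge0_emeasurable_sum => [k x _ _|k _]; case: (mu k).
by move=> x; apply: nneseries_ge0 => k _ _; case: (mu k).
Qed.

Lemma posop_integral d (T : measurableType d) (mu : {measure set T -> \bar R}) :
  positive_operator (fun w (_ : unit) => \int[mu]_x w x).
Proof.
split.
- move=> w [mw w0]; split; first exact: measurable_cst.
  by move=> _; exact: integral_ge0.
- by move=> v w [mv v0] [mw w0] vw _; apply: ge0_le_integral.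
- by move=> v w [mv v0] [mw w0] _; rewrite ge0_integralD.
- by move=> c w c0 [mw w0] _; rewrite ge0_integralZl.
- by move=> u mu' _; rewrite integral_nneseries// => n => [|x _]; case: (mu' n).
Qed.

Lemma posop_kernel d1 d2 (T1 : measurableType d1) (T2 : measurableType d2)
    (k : R.-pker T1 ~> T2) :
  positive_operator (fun (w : T1 * T2 -> \bar R) x => \int[k x]_y w (x, y)).
Proof.
have sec (w : T1 * T2 -> \bar R) x : nonneg_measurable w ->
    nonneg_measurable (fun y => w (x, y)).
  by move=> [mw w0]; split => //; exact: measurableT_comp mw _.
split.
- move=> w [mw w0]; split; first exact: measurable_fun_integral_sfinite_kernel.
  by move=> x; exact: integral_ge0.
- move=> v w mv mw vw x; have [? ?] := sec _ x mv; have [? ?] := sec _ x mw.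
  by apply: ge0_le_integral.
- move=> v w mv mw x; have [? ?] := sec _ x mv; have [? ?] := sec _ x mw.
  by rewrite ge0_integralD.
- by move=> c w c0 mw x; have [? ?] := sec _ x mw; rewrite ge0_integralZl.
- by move=> u mu x; rewrite integral_nneseries// => n => [|y _];
    have [? ?] := sec _ x (mu n).
Qed.

Lemma posop_comp d1 d2 d3 (T1 : measurableType d1) (T2 : measurableType d2)
    (T3 : measurableType d3) (L1 : (T1 -> \bar R) -> T2 -> \bar R)
    (L2 : (T2 -> \bar R) -> T3 -> \bar R) :
  positive_operator L1 -> positive_operator L2 ->
  positive_operator (fun w => L2 (L1 w)).
Proof.
move=> p1 p2; have n1 := posop_nonneg p1; split.
- by move=> w mw; apply: (posop_nonneg p2); exact: n1.
- move=> v w mv mw vw; apply: (posop_le p2) => [| |x]; [exact: n1|exact: n1|].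
  exact: (posop_le p1).
- move=> v w mv mw z; rewrite -(posop_add p2); [|exact: n1|exact: n1].
  by congr (L2 _ z); apply/funext => x; exact: (posop_add p1).
- move=> c w c0 mw z; rewrite -(posop_scale p2)//; last exact: n1.
  by congr (L2 _ z); apply/funext => x; exact: (posop_scale p1).
- move=> u mu z; rewrite -(posop_series p2); last by move=> n; exact: n1.
  by congr (L2 _ z); apply/funext => x; exact: (posop_series p1).
Qed.

Lemma posop_precomp d1 d2 (T1 : measurableType d1) (T2 : measurableType d2)
    (f : T2 -> T1) : measurable_fun setT f ->
  positive_operator (fun (w : T1 -> \bar R) z => w (f z)).
Proof.
move=> mf; split => //.
by move=> w [mw w0]; split => //; exact: measurableT_comp.
Qed.

Lemma posop_mult d (T : measurableType d) (v : T -> R) :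
  measurable_fun setT v -> (forall x, 0 <= v x)%R ->
  positive_operator (fun w x => (v x)%:E * w x).
Proof.
move=> mv v0; split.
- move=> w [mw w0]; split; last by move=> x; rewrite mule_ge0// lee_fin.
  by apply: emeasurable_funM => //; exact/measurable_EFinP.
- by move=> u w _ _ uw z; rewrite lee_wpmul2l// lee_fin.
- by move=> u w [_ u0] [_ w0] z; rewrite ge0_muleDr.
- by move=> c w c0 _ z; rewrite muleCA.
- by move=> u mu z; rewrite nneseriesZl// => n _; case: (mu n).
Qed.

Lemma posop_iter d (T : measurableType d) (L : (T -> \bar R) -> T -> \bar R) n :
  positive_operator L -> positive_operator (iter n L).
Proof.
move=> pL; elim: n => [|n IHn]; last exact: posop_comp IHn pL.
by split.
Qed.

Lemma posop_sum d1 d2 (T1 : measurableType d1) (T2 : measurableType d2)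
    (L : nat -> (T1 -> \bar R) -> T2 -> \bar R) :
  (forall n, positive_operator (L n)) ->
  positive_operator (fun w z => \sum_(n <oo) L n w z).
Proof.
move=> pL; have nL n w : nonneg_measurable w -> nonneg_measurable (L n w).
  exact: (posop_nonneg (pL n)).
split.
- by move=> w mw; apply: nonneg_measurable_series => n; exact: nL.
- move=> v w mv mw vw z; apply: lee_nneseries => [n _ _|n _].
    by case: (nL n _ mv).
  exact: (posop_le (pL n)).
- move=> v w mv mw z; rewrite -nneseriesD => [|n _ _|n _ _].
  + by apply: eq_eseriesr => n _; exact: (posop_add (pL n)).
  + by case: (nL n _ mv).
  + by case: (nL n _ mw).
- move=> c w c0 mw z; rewrite -nneseriesZl => [|n _]; last by case: (nL n _ mw).
  by apply: eq_eseriesr => n _; exact: (posop_scale (pL n)).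
- move=> u mu z; rewrite -(@nneseries_interchange _ _ xpredT xpredT).
    by apply: eq_eseriesr => n _; exact: (posop_series (pL n)).
  by move=> i j; case: (nL i _ (mu j)).
Qed.

Lemma posop_sum_ord d1 d2 (T1 : measurableType d1) (T2 : measurableType d2)
    (L : (T1 -> \bar R) -> T2 -> \bar R) (u : nat -> T1 -> \bar R) n :
  positive_operator L -> (forall k, nonneg_measurable (u k)) ->
  forall z, L (fun x => \sum_(k < n) u k x) z = \sum_(k < n) L (u k) z.
Proof.
move=> pL mu z; elim: n => [|n IHn].
  (* That [L] maps zero to zero is the case [c = 0] of [posop_scale], with the convention
     [0 * +oo = 0]. *)
  rewrite big_ord0 -[RHS](mul0e (L (u 0%N) z)) -(posop_scale pL)//.
  by congr (L _ z); apply/funext => x; rewrite big_ord0 mul0e.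
rewrite big_ord_recr /= -IHn -(posop_add pL)//; last exact: nonneg_measurable_sum.
by congr (L _ z); apply/funext => x; rewrite big_ord_recr.
Qed.

Section resolvent.
Context {d : measure_display} {T : measurableType d}
  (L : (T -> \bar R) -> T -> \bar R) (pL : positive_operator L).

(** The Neumann series of the inverse of [1 - L]. For [L = dstep] it is the expected discounted sum
    of [w] along a killed trajectory started at [z]. *)
Definition resolvent (w : T -> \bar R) (z : T) : \bar R :=
  \sum_(n <oo) iter n L w z.

Lemma posop_resolvent : positive_operator resolvent.
Proof. by apply: posop_sum => n; exact: posop_iter. Qed.

Lemma resolventE w : nonneg_measurable w ->
  forall z, resolvent w z = w z + L (resolvent w) z.
Proof.
move=> mw z; have mi n : nonneg_measurable (iter n L w).
  exact: (posop_nonneg (posop_iter n pL)).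
rewrite [in RHS]/resolvent (posop_series pL)// /resolvent nneseries_recl//=.
  by congr (_ + _); rewrite -(@nneseries_addn _ _ 1%N) => [|n];
    [apply: eq_eseriesr => n _; rewrite addn1|case: (mi n)].
by move=> n _; case: (mi n).
Qed.

(** The resolvent lies below every nonnegative supersolution: each partial sum stays below [v] by
    induction, since [w + L (partial sum) <= w + L v <= v]. *)
Lemma resolvent_le w v : nonneg_measurable w -> nonneg_measurable v ->
  (forall z, w z + L v z <= v z) -> forall z, resolvent w z <= v z.
Proof.
move=> mw mv wv z; have mi n : nonneg_measurable (iter n L w).
  exact: (posop_nonneg (posop_iter n pL)).
apply: lime_le; first by apply: is_cvg_nneseries => n _ _; case: (mi n).
apply: nearW => n; rewrite big_mkord; elim: n z => [|n IHn] z.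
  by rewrite big_ord0; case: mv.
rewrite big_ord_recl; apply: le_trans (wv z); rewrite leeD2l//.
apply: le_trans (posop_le pL (nonneg_measurable_sum n mi) mv IHn z).
by rewrite (posop_sum_ord n pL mi).
Qed.

End resolvent.

End positive_operators.

(** * Integration against a set function known on measurable sets *)

Section integral_set_function.
Context {R : realType} {d : measure_display} {T : measurableType d}.
Local Open Scope ereal_scope.
Import HBNNSimple.

Lemma sintegral_nonpos (mu : set T -> \bar R) (h : {nnsfun T >-> R}) :
  mu set0 = 0 -> (forall x, (h x)%:E <= 0) -> sintegral mu h = 0.
Proof.
move=> mu0 h0; rewrite /sintegral fsbig1// => r _.
have [->|r0] := eqVneq r 0%R; first by rewrite mul0e.
rewrite (_ : h @^-1` [set r] = set0) ?mu0 ?mule0//; apply/seteqP; split => // x /= hr.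
by move/eqP: r0; apply; apply/eqP; rewrite eq_le -hr -lee_fin h0/=.
Qed.

(** The integral is a difference of two suprema, for the positive and the negative part. This
    disposes of the negative part of a nonnegative function when [mu] is not known to be a
    measure. *)
Lemma sup_sintegral_nonpos (mu : set T -> \bar R) : mu set0 = 0 ->
  ereal_sup [set sintegral mu h | h in
    [set h : {nnsfun T >-> R} | forall x, (h x)%:E <= (fun=> 0) x]] = 0.
Proof.
move=> mu0; apply/eqP; rewrite eq_le; apply/andP; split.
  by apply: ge_ereal_sup => _ [h /= h0 <-]; rewrite sintegral_nonpos.
by apply: ereal_sup_ubound; exists nnsfun0 => //; exact: sintegral_nonpos.
Qed.

Lemma integral0_set_function (mu : set T -> \bar R) :
  mu set0 = 0 -> \int[mu]_x (cst 0 x) = 0.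
Proof.
move=> mu0; rewrite /integral patch_setT.
have -> : (cst 0 : T -> \bar R)^\+ = (fun=> 0).
  by apply/funext => x; rewrite funeposE maxxx.
have -> : (cst 0 : T -> \bar R)^\- = (fun=> 0).
  by apply/funext => x; rewrite funenegE /cst oppe0 maxxx.
by rewrite !(sup_sintegral_nonpos mu0) sube0.
Qed.

Lemma sintegral_le_integral (mu : set T -> \bar R) (f : T -> R)
    (g : {nnsfun T >-> R}) :
  mu set0 = 0 -> (forall x, 0 <= f x)%R -> (forall x, g x <= f x)%R ->
  sintegral mu g <= \int[mu]_x (f x)%:E.
Proof.
move=> mu0 f0 gf; rewrite /integral patch_setT.
have -> : (fun x => (f x)%:E)^\+ = (fun x => (f x)%:E).
  by apply/funext => x; rewrite funeposE; apply/max_idPl; rewrite lee_fin.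
have -> : (fun x => (f x)%:E)^\- = (fun=> 0).
  by apply/funext => x; rewrite funenegE; apply/max_idPr; rewrite -EFinN lee_fin oppr_le0.
rewrite (sup_sintegral_nonpos mu0) sube0.
by apply: ereal_sup_ubound; exists g => // x; rewrite lee_fin.
Qed.

Context {d2 : measure_display} {T2 : measurableType d2}
  (L : (T -> \bar R) -> T2 -> \bar R) (pL : positive_operator L) (z : T2)
  (mu : set T -> \bar R).
Hypothesis muL : forall B, measurable B -> mu B = L (fun x => (\1_B x)%:E) z.

Let posop_0 : L (fun=> 0) z = 0.
Proof.
have m0 : nonneg_measurable (fun _ : T => 0 : \bar R) by split => //; exact: measurable_cst.
rewrite -[RHS](mul0e (L (fun=> 0) z)) -(posop_scale pL)//.
by congr (L _ z); apply/funext => x; rewrite mul0e.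
Qed.

Let mu_set0 : mu set0 = 0.
Proof.
rewrite muL// -[RHS]posop_0; congr (L _ z); apply/funext => x.
by rewrite indic0.
Qed.

Let nonneg_nnsfun (g : {nnsfun T >-> R}) : nonneg_measurable (EFin \o g).
Proof. by split; [exact/measurable_EFinP|move=> x; rewrite lee_fin]. Qed.

Lemma posop_nnsfun (g : {nnsfun T >-> R}) : L (EFin \o g) z = sintegral mu g.
Proof.
have -> : sintegral mu g = \sum_(r \in range g) r%:E * mu (g @^-1` [set r]).
  rewrite /sintegral (fsbig_widen (range g) setT)//= => x [_ Nfx] /=.
  by rewrite preimage10// mu_set0 mule0.
have fr : finite_set (range g) by exact: fimfunP.
rewrite fsbig_finite//=.
have -> : EFin \o g = (fun x => \sum_(r <- fset_set (range g))
    (r * \1_(g @^-1` [set r]) x)%:E).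
  by apply/funext => x /=; rewrite fimfunE fsbig_finite//= sumEFin.
have term r : nonneg_measurable (fun x => (r * \1_(g @^-1` [set r]) x)%:E).
  split; last by move=> x; exact: nnfun_muleindic_ge0.
  by apply/measurable_EFinP; apply: measurable_funM => //; exact: measurable_indic.
have : forall r, r \in enum_fset (fset_set (range g)) -> (0 <= r)%R.
  move=> r rg; suff /set_mem [x _ <-] : r \in range g by [].
  by rewrite -in_fset_set.
elim: (enum_fset _) => [_|r s IHs s0].
  rewrite big_nil -[RHS]posop_0; congr (L _ z); apply/funext => x.
  by rewrite big_nil.
have r0 : (0 <= r)%R by apply: s0; rewrite mem_head.
rewrite big_cons -IHs; last by move=> r' r's; apply: s0; rewrite inE r's orbT.
have mi : nonneg_measurable (fun x => (\1_(g @^-1` [set r]) x)%:E).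
  split; last by move=> x; rewrite lee_fin.
  by apply/measurable_EFinP; exact: measurable_indic.
rewrite muL// -(posop_scale pL)// -(posop_add pL).
- by congr (L _ z); apply/funext => x; rewrite big_cons EFinM.
- exact: nonneg_measurable_scale.
- have [mt t0] : (forall r, measurable_fun setT (fun x => (r * \1_(g @^-1` [set r]) x)%:E)) /\
    (forall r x, 0 <= (r * \1_(g @^-1` [set r]) x)%:E).
    by split => r'; have [] := term r'.
  by split => [|x]; [exact: emeasurable_sum|exact: sume_ge0].
Qed.

(** The function [f] is the series of increments [u] of an increasing sequence of simple functions,
    so [posop_series] serves as monotone convergence for [L]. On a simple function [L] is a
    [sintegral], and for those below [f] this is at most the integral, a supremum. *)
Lemma posop_le_integral (f : T -> R) :
  measurable_fun setT f -> (forall x, 0 <= f x)%R ->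
  L (EFin \o f) z <= \int[mu]_x (f x)%:E.
Proof.
move=> mf f0; have mef : measurable_fun setT (EFin \o f) by exact/measurable_EFinP.
pose fn := nnsfun_approx measurableT mef.
have ndf x m n : (m <= n)%N -> (fn m x <= fn n x)%R.
  by move=> mn; have /lefP := nd_nnsfun_approx measurableT mef mn; exact.
have cvf x : (fn n x)%:E @[n --> \oo] --> (f x)%:E.
  by apply: cvg_nnsfun_approx => // ? _; rewrite lee_fin.
have lef n x : (fn n x <= f x)%R.
  rewrite -lee_fin -(cvg_lim (@ereal_hausdorff R) (cvf x)).
  apply: lime_ge; first by apply/cvg_ex; exists (f x)%:E.
  by exists n => // k nk; rewrite /= lee_fin ndf.
have Lfn n : L (EFin \o fn n) z <= \int[mu]_x (f x)%:E.
  by rewrite posop_nnsfun; exact: sintegral_le_integral.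
pose u n x := if n is n'.+1 then (fn n x - fn n' x)%:E else (fn 0%N x)%:E.
have mu_ n : nonneg_measurable (u n).
  case: n => [|n]; first exact: (nonneg_nnsfun (fn 0%N)).
  split; last by move=> x; rewrite lee_fin subr_ge0 ndf.
  by apply/measurable_EFinP; apply: measurable_funB.
have sumu n x : \sum_(k < n.+1) u k x = (fn n x)%:E.
  elim: n => [|n IHn]; first by rewrite big_ord_recl big_ord0 adde0.
  by rewrite big_ord_recr /= IHn -EFinD addrC subrK.
have -> : EFin \o f = (fun x => \sum_(n <oo) u n x).
  apply/funext => x /=; apply/esym/cvg_lim => //.
  rewrite -(cvg_shiftS (fun n => \sum_(0 <= k < n) u k x)) /=.
  by under eq_fun do rewrite big_mkord sumu; exact: cvf.
rewrite (posop_series pL)//; apply: lime_le.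
  by apply: is_cvg_nneseries => n _ _; case: (posop_nonneg pL (mu_ n)).
apply: nearW => -[|n]; rewrite big_mkord.
  rewrite big_ord0; apply: le_trans (Lfn 0%N).
  by case: (posop_nonneg pL (nonneg_nnsfun (fn 0%N))).
rewrite -(posop_sum_ord _ pL)//; apply: le_trans (Lfn n).
by rewrite (_ : (fun x => \sum_(k < n.+1) u k x) = EFin \o fn n)//; apply/funext => x; rewrite sumu.
Qed.

End integral_set_function.

(** * Trajectories as iterates of a killed transition operator *)

Section trajectories.
Context {R : realType} {dS dA dC : measure_display} {S : measurableType dS}
  {A : measurableType dA} {C : measurableType dC} (M : cgo R S A C).
Local Notation X := (S * C)%type.
Local Notation XA := (S * C * A)%type.
Local Notation Xbar := (option S * C)%type.
Local Notation gamma := (discount M).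
Local Notation goalX := (goalX M).

(** The transition kernel reindexed by [((s, c), a)], so that [posop_kernel] applies to it. *)
Definition next_state (z : XA) : {measure set S -> \bar R} :=
  trans M (z.1.1, z.2).

Let measurable_next_state U : measurable U ->
  measurable_fun setT (next_state ^~ U).
Proof.
move=> mU; apply: measurableT_comp (measurable_kernel (trans M) U mU) _.
apply: measurable_fun_pair => //.
exact: measurableT_comp.
Qed.
HB.instance Definition _ := isKernel.Build _ _ _ _ _ next_state measurable_next_state.

Let next_state_prob z : next_state z setT = 1%E.
Proof. exact: prob_kernel. Qed.
HB.instance Definition _ := Kernel_isProbability.Build _ _ _ _ _ next_state next_state_prob.

Variable pi : R.-pker X ~> A.

Definition policy_mean (w : XA -> \bar R) (x : X) : \bar R :=
  (\int[pi x]_a w (x, a))%E.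

Lemma posop_policy_mean : positive_operator policy_mean.
Proof. exact: posop_kernel. Qed.

(* One undiscounted step of the original MDP, killed on entering the goal. *)
Definition step (w : XA -> \bar R) (z : XA) : \bar R :=
  ((\1_(~` goalX) z.1)%:E *
   \int[next_state z]_s policy_mean w (s, z.1.2))%E.

Lemma posop_step : positive_operator step.
Proof.
apply: (@posop_comp _ _ _ _ _ _ _ (fun w z => \int[next_state z]_s policy_mean w (s, z.1.2))%E
   (fun w z => (\1_(~` goalX) z.1)%:E * w z)%E).
  apply: (@posop_comp _ _ _ _ _ _ _
    (fun w (y : XA * S) => policy_mean w (y.2, y.1.1.2)) (fun w z => \int[next_state z]_s w (z, s))%E).
    apply: (@posop_comp _ _ _ _ _ _ _ policy_mean
      (fun w (y : XA * S) => w (y.2, y.1.1.2)) posop_policy_mean).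
    apply: (posop_precomp (f := fun y : XA * S => (y.2, y.1.1.2))).
    apply: measurable_fun_pair => //; apply: measurableT_comp => //.
    exact: measurableT_comp.
  exact: (posop_kernel next_state).
apply: posop_mult => [|x]; last by rewrite indicE.
apply: measurableT_comp => //; apply: measurable_indic; apply: measurableC.
exact: measurable_goal.
Qed.

Definition dstep (w : XA -> \bar R) (z : XA) : \bar R := (gamma%:E * step w z)%E.

Lemma posop_dstep : positive_operator dstep.
Proof.
apply: (@posop_comp _ _ _ _ _ _ _ step (fun w z => (gamma%:E * w z)%E)).
  exact: posop_step.
by apply: posop_mult => // _; exact: discount_ge0.
Qed.

(** Moves the discount from the single steps to the end of the path, where the functionals
    integrated by [path_exp] carry it. *)
Lemma iter_dstep t w : nonneg_measurable w -> forall z,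
  iter t dstep w z = iter t step (fun z => (gamma ^+ t)%:E * w z)%E z.
Proof.
move=> mw; have g0 := discount_ge0 M; elim: t => [|t IHt] z /=.
  by rewrite expr0 mul1e.
have pt k : positive_operator (iter k step) := posop_iter k posop_step.
have gt0 k : 0 <= gamma ^+ k by exact: exprn_ge0.
have -> : iter t step (fun z => ((gamma ^+ t.+1)%:E * w z)%E) =
    (fun z => (gamma%:E * iter t dstep w z)%E).
  apply/funext => z'; rewrite IHt -(posop_scale (pt t))//; last exact: nonneg_measurable_scale.
  by congr (iter t step _ z'); apply/funext => y; rewrite exprS EFinM muleA.
rewrite (posop_scale posop_step)//.
exact: (posop_nonneg (posop_iter t posop_dstep)).
Qed.

Lemma goalXbarE (x : X) : goalXbar M (inX x) <-> goalX x.
Proof.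
split; last by move=> gx; exists x.
by case: x => s c [[s' c'] /= gx [<- <-]].
Qed.

Lemma path_exp_None Phi t h c a :
  (forall h c a, Phi (rcons h ((None, c), a)) = 0%E) ->
  path_exp M pi t h (None, c) a Phi = 0%E.
Proof. by move=> Phi0; elim: t h a => [|t IHt] h a /=. Qed.

(** The invariant is that the history has not visited the goal. When the current state is a goal,
    the path moves to [None], where [Phi] vanishes, and the indicator in [step] vanishes as well. *)
Lemma path_exp_step Phi w T :
  (forall h c a, Phi (rcons h ((None, c), a)) = 0%E) ->
  (forall h x a, all (fun z => ~~ `[< goalXbar M z.1 >]) h -> size h = T ->
    Phi (rcons h (inX x, a)) = w (x, a)) ->
  forall t h x a, all (fun z => ~~ `[< goalXbar M z.1 >]) h -> (size h + t = T)%N ->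
    path_exp M pi t h (inX x) a Phi = iter t step w (x, a).
Proof.
move=> Phi0 Phiw; elim=> [|t IHt] h [s c] a hG hT.
  by rewrite addn0 in hT; exact: Phiw.
rewrite /= /step /=; case: asboolP => gx.
  by rewrite path_exp_None// indicE memNset ?mul0e//; exact.
rewrite indicE mem_set// mul1e; apply: eq_integral => s' _ /=.
apply: eq_integral => a' _; apply: (IHt (rcons h _) (s', c)).
  by rewrite all_rcons hG andbT; apply/asboolPn => /(goalXbarE (s, c)).
by rewrite size_rcons addSnnS.
Qed.

(** A common format for the return and both occupancies: zero after absorption, and [gamma ^ t]
    times a function of the current pair if the goal was not visited before time [t]. *)
Lemma traj_exp_fromE Z w :
  nonneg_measurable w ->
  (forall t h c a, Z t (rcons h ((None, c), a)) = 0%E) ->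
  (forall t h x a, all (fun z => ~~ `[< goalXbar M z.1 >]) h -> size h = t ->
    Z t (rcons h (inX x, a)) = ((gamma ^+ t)%:E * w (x, a))%E) ->
  forall x a, traj_exp_from M pi Z (inX x) a = resolvent dstep w (x, a).
Proof.
move=> mw Z0 Zw x a; apply: eq_eseriesr => t _; rewrite iter_dstep//.
by apply: (@path_exp_step _ _ t) => //; exact: Zw.
Qed.

Lemma current_rcons (h : seq (Xbar * A)) z : current (rcons h z) = z.
Proof. by rewrite /current last_rcons. Qed.

Lemma hit_time_rcons (h : seq (Xbar * A)) x a :
  all (fun z => ~~ `[< goalXbar M z.1 >]) h ->
  hit_time M (rcons h (inX x, a)) = (if `[< goalX x >] then size h else (size h).+1).
Proof.
move=> hG; rewrite /hit_time -cats1 find_cat.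
rewrite (_ : has _ h = false); last by apply/negbTE; rewrite -all_predC.
rewrite /=; have -> : `[< goalXbar M (inX x) >] = `[< goalX x >].
  by apply/asboolP/asboolP => /goalXbarE.
by case: ifP; rewrite ?addn0 ?addn1.
Qed.

(** The expected discounted sum of [w] up to and including the first visit to the goal: [dstep]
    kills the step that leaves the goal, not the one that enters it. *)
Definition value (w : XA -> \bar R) : \bar R :=
  (\int[init M]_x policy_mean (resolvent dstep w) x)%E.

End trajectories.

(** * Occupancies and returns as instances of [value] *)

Lemma indic_in (R : nzRingType) (T : Type) (B : set T) (x : T) :
  B x -> \1_B x = 1 :> R.
Proof. by move=> Bx; rewrite indicE mem_set. Qed.

Lemma indic_notin (R : nzRingType) (T : Type) (B : set T) (x : T) :
  ~ B x -> \1_B x = 0 :> R.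
Proof. by move=> Bx; rewrite indicE memNset. Qed.

Section occupancies.
Context {R : realType} {dS dA dC : measure_display} {S : measurableType dS}
  {A : measurableType dA} {C : measurableType dC} (M : cgo R S A C).
Local Notation X := (S * C)%type.
Local Notation XA := (S * C * A)%type.
Local Notation gamma := (discount M).
Local Notation goalX := (goalX M).
Variable pi : R.-pker X ~> A.
Local Notation dstep := (dstep M pi).
Local Notation value := (value M pi).
Local Notation policy_mean := (policy_mean pi).

Lemma reward_inX (x : X) : reward M (inX x) = \1_goalX x.
Proof.
rewrite /reward !indicE; congr ((nat_of_bool _)%:R).
by apply/idP/idP => /set_mem/goalXbarE/mem_set.
Qed.

Lemma measurable_goalX : measurable goalX.
Proof. exact: measurable_goal. Qed.

Lemma measurable_goal_indic : measurable_fun setT (\1_goalX : X -> R).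
Proof. exact: (measurable_indic measurable_goalX). Qed.

Lemma measurable_nongoal_indic : measurable_fun setT (\1_(~` goalX) : X -> R).
Proof. by apply: measurable_indic; apply: measurableC; exact: measurable_goalX. Qed.

Lemma nongoal_indicE (x : X) : \1_(~` goalX) x = 1 - \1_goalX x :> R.
Proof. by rewrite !indicE in_setC; case: (_ \in _) => /=; ring. Qed.

Lemma nonneg_measurable_EFin d (T : measurableType d) (f : T -> R) :
  measurable_fun setT f -> (forall x, 0 <= f x) -> nonneg_measurable (EFin \o f).
Proof. by move=> mf f0; split; [exact/measurable_EFinP|move=> x; rewrite lee_fin]. Qed.

Lemma posop_value : positive_operator (fun w (_ : unit) => value w).
Proof.
apply: (@posop_comp _ _ _ _ _ _ _ (fun w => policy_mean (resolvent dstep w))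
  (fun w (_ : unit) => \int[init M]_x w x)%E); last exact: posop_integral.
apply: (@posop_comp _ _ _ _ _ _ _ (resolvent dstep) policy_mean).
  by apply: posop_resolvent; exact: posop_dstep.
exact: posop_policy_mean.
Qed.

Lemma traj_expE Z w : nonneg_measurable w ->
  (forall t h c a, Z t (rcons h ((None, c), a)) = 0%E) ->
  (forall t h x a, all (fun z => ~~ `[< goalXbar M z.1 >]) h -> size h = t ->
    Z t (rcons h (inX x, a)) = ((gamma ^+ t)%:E * w (x, a))%E) ->
  traj_exp M pi Z = value w.
Proof.
move=> mw Z0 Zw; apply: eq_integral => -[s c] _ /=; apply: eq_integral => a _.
exact: (traj_exp_fromE pi mw Z0 Zw (s, c)).
Qed.

Lemma Qfun_resolvent (x : X) (a : A) :
  Qfun M pi (inX x) a = resolvent dstep (fun z => (\1_goalX z.1)%:E) (x, a).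
Proof.
apply: traj_exp_fromE => [|t h c b|t h y b hG ht].
- apply: nonneg_measurable_EFin => [|z]; last by rewrite indicE.
  by apply: measurableT_comp => //; exact: measurable_goal_indic.
- rewrite current_rcons /reward indicE memNset ?mulr0// => -[[s' c'] _].
  by [].
- by rewrite current_rcons reward_inX EFinM.
Qed.

Lemma Jval_value : Jval M pi = value (fun z => (\1_goalX z.1)%:E).
Proof.
apply: eq_integral => x _; apply: eq_integral => a _; exact: Qfun_resolvent.
Qed.

(** For a path up to time [t] without earlier goal visit, [hit_time] is [t] or [t + 1] according to
    whether the last state is a goal, so [t < hit_time] is the indicator of the complement of the
    goal at that state. *)
Lemma occ_notin_value (B : set XA) : measurable B ->
  occ_notin M pi B = value (fun z => (\1_(~` goalX) z.1)%:E * (\1_B z)%:E)%E.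
Proof.
move=> mB; apply: traj_expE => [|t h c b|t h x b hG ht].
- apply: (@nonneg_measurable_EFin _ _ (fun z => \1_(~` goalX) z.1 * \1_B z)).
    apply: measurable_funM; last exact: measurable_indic.
    by apply: measurableT_comp => //; exact: measurable_nongoal_indic.
  by move=> z; rewrite !indicE mulr_ge0.
- rewrite current_rcons indicE memNset ?mulr0 ?if_same// => -[z _].
  by [].
- rewrite hit_time_rcons// current_rcons ht.
  have -> : \1_[set (inX z.1, z.2) | z in B] (inX x, b) = \1_B (x, b) :> R.
    rewrite !indicE; congr ((nat_of_bool _)%:R); apply/idP/idP => /set_mem.
      by case: x => s c [[[s' c'] b'] /= Bz [<- <- <-]]; exact: mem_set.
    by move=> Bx; apply/mem_set; exists (x, b).
  case: asboolP => gx; first by rewrite ltnn (@indic_notin _ _ (~` goalX))//= mul0e mule0.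
  by rewrite ltnSn (@indic_in _ _ (~` goalX))// mul1e EFinM.
Qed.

Lemma occ_in_value (B : set X) : measurable B ->
  occ_in M pi B = value (fun z => (\1_goalX z.1)%:E * (\1_B z.1)%:E)%E.
Proof.
move=> mB; apply: traj_expE => [|t h c b|t h x b hG ht].
- apply: (@nonneg_measurable_EFin _ _ (fun z => \1_goalX z.1 * \1_B z.1)).
    apply: measurable_funM; apply: measurableT_comp => //.
    exact: measurable_goal_indic.
  by move=> z; rewrite !indicE mulr_ge0.
- rewrite current_rcons indicE memNset ?mulr0 ?if_same// => -[z _].
  by [].
- rewrite hit_time_rcons// current_rcons ht /=.
  have -> : \1_((fun y : X => inX y) @` B) (inX x) = \1_B x :> R.
    rewrite !indicE; congr ((nat_of_bool _)%:R); apply/idP/idP => /set_mem.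
      by case: x => s c [[s' c'] /= Bz [<- <-]]; exact: mem_set.
    by move=> Bx; apply/mem_set; exists x.
  case: asboolP => gx; first by rewrite eqxx (@indic_in _ _ goalX)// mul1e EFinM.
  by rewrite -[X in (if X then _ else _)]negbK neq_ltn ltnSn orbT /=
    (@indic_notin _ _ goalX)// mul0e mule0.
Qed.

Lemma value_le_occ_notin (f : XA -> R) :
  measurable_fun setT f -> (forall z, 0 <= f z) ->
  (value (fun z => (\1_(~` goalX) z.1)%:E * (f z)%:E) <=
   \int[occ_notin M pi]_z (f z)%:E)%E.
Proof.
move=> mf f0.
have pm : positive_operator (fun (w : XA -> \bar R) z => (\1_(~` goalX) z.1)%:E * w z)%E.
  apply: posop_mult => [|z]; last by rewrite indicE.
  by apply: measurableT_comp => //; exact: measurable_nongoal_indic.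
exact: (posop_le_integral (posop_comp pm posop_value) (z := tt) occ_notin_value mf f0).
Qed.

Lemma value_le_occ_in (f : X -> R) :
  measurable_fun setT f -> (forall z, 0 <= f z) ->
  (value (fun z => (\1_goalX z.1)%:E * (f z.1)%:E) <=
   \int[occ_in M pi]_z (f z)%:E)%E.
Proof.
move=> mf f0.
have pm : positive_operator (fun (w : XA -> \bar R) z => (\1_goalX z.1)%:E * w z)%E.
  apply: posop_mult => [|z]; last by rewrite indicE.
  by apply: measurableT_comp => //; exact: measurable_goal_indic.
have pf : positive_operator (fun (w : X -> \bar R) (z : XA) => w z.1).
  exact: posop_precomp.
exact: (posop_le_integral (posop_comp (posop_comp pf pm) posop_value) (z := tt)
  occ_in_value mf f0).
Qed.

End occupancies.

(** * Performance difference *)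

Lemma indic_unit (R : realType) (T : Type) (B : set T) (x : T) :
  0 <= (\1_B x : R) <= 1.
Proof. by rewrite indicE ler0n lern1 leq_b1. Qed.

Section performance.
Context {R : realType} {dS dA dC : measure_display} {S : measurableType dS}
  {A : measurableType dA} {C : measurableType dC} (M : cgo R S A C).
Local Notation X := (S * C)%type.
Local Notation XA := (S * C * A)%type.
Local Notation gamma := (discount M).
Local Notation goalX := (goalX M).
Variable pi : R.-pker X ~> A.
Local Notation dstep := (dstep M pi).
Local Notation value := (value M pi).
Local Notation policy_mean := (policy_mean pi).

Lemma policy_mean_cst (r : \bar R) x : policy_mean (fun=> r) x = r.
Proof. by rewrite /policy_mean integral_cst// prob_kernel mule1. Qed.

Lemma dstep_cst (r : R) z :
  dstep (fun=> r%:E) z = (gamma * (\1_(~` goalX) z.1 * r))%:E.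
Proof.
rewrite /dstep /step; under eq_integral do rewrite policy_mean_cst.
by rewrite integral_cst// prob_kernel mule1.
Qed.

Lemma nonneg_measurable_cst d (T : measurableType d) (r : R) : 0 <= r ->
  nonneg_measurable (fun _ : T => r%:E).
Proof. by move=> r0; split => [|x]; [exact: measurable_cst|rewrite lee_fin]. Qed.

Let m1goal : nonneg_measurable (fun z : XA => (\1_goalX z.1)%:E : \bar R).
Proof.
apply: nonneg_measurable_EFin => [|z]; last by rewrite indicE.
by apply: measurableT_comp => //; exact: measurable_goal_indic.
Qed.

Let m1ngoal : nonneg_measurable (fun z : XA => (\1_(~` goalX) z.1)%:E : \bar R).
Proof.
apply: nonneg_measurable_EFin => [|z]; last by rewrite indicE.
by apply: measurableT_comp => //; exact: measurable_nongoal_indic.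
Qed.

(** The constant 1 is a supersolution, since [1_G + gamma (1 - 1_G) <= 1]: the trajectory is killed
    where the reward is paid. *)
Lemma resolvent_goal_le1 z : (resolvent dstep (fun z => (\1_goalX z.1)%:E) z <= 1)%E.
Proof.
apply: (@resolvent_le _ _ _ _ (posop_dstep M pi) _ (fun=> 1%:E)) => //.
move=> {}z; rewrite dstep_cst lee_fin mulr1 nongoal_indicE.
have := discount_ge0 M; have := discount_lt1 M.
have : 0 <= (\1_goalX z.1 : R) <= 1 by exact: indic_unit.
by move=> /andP[? ?] ? ?; nra.
Qed.

Lemma value_le (w : XA -> \bar R) (r : R) :
  nonneg_measurable w -> 0 <= r -> (forall z, resolvent dstep w z <= r%:E)%E ->
  (value w <= r%:E)%E.
Proof.
move=> mw r0 wr.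
have pr := posop_resolvent (posop_dstep M pi).
have -> : r%:E = (\int[init M]_x policy_mean (fun=> r%:E) x)%E.
  under eq_integral do rewrite policy_mean_cst.
  by rewrite integral_cst//= -[LHS]mule1; congr (_ * _)%E; rewrite (probability_setT (init M)).
have mr := nonneg_measurable_cst XA r0.
have [m1 m10] := posop_nonneg (posop_policy_mean pi) (posop_nonneg pr mw).
have [m2 m20] := posop_nonneg (posop_policy_mean pi) mr.
apply: ge0_le_integral => // x _.
exact: (posop_le (posop_policy_mean pi)) (posop_nonneg pr mw) mr wr x.
Qed.

Lemma value_goal_le1 : (value (fun z => (\1_goalX z.1)%:E) <= 1)%E.
Proof. by apply: value_le => //; exact: resolvent_goal_le1. Qed.

Lemma value_nongoal_le : (value (fun z => (\1_(~` goalX) z.1)%:E) <= ((1 - gamma)^-1)%:E)%E.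
Proof.
have g1 : 0 < 1 - gamma by rewrite subr_gt0 discount_lt1.
have i0 : 0 <= (1 - gamma)^-1 by rewrite invr_ge0 ltW.
apply: value_le => // z.
apply: (@resolvent_le _ _ _ _ (posop_dstep M pi) _ (fun=> ((1 - gamma)^-1)%:E)) => //.
move=> {}z; rewrite dstep_cst lee_fin.
have : 0 <= (\1_(~` goalX) z.1 : R) <= 1 by exact: indic_unit.
have e : (1 - gamma)^-1 = 1 + gamma * (1 - gamma)^-1 by field; rewrite gt_eqF.
move=> /andP[? ?]; rewrite [leRHS]e lerD// ler_wpM2l ?discount_ge0//.
by rewrite ler_piMl.
Qed.

Lemma Rintegral_unit d (T : measurableType d) (mu : {measure set T -> \bar R})
    (f : T -> R) : mu setT = 1%E -> measurable_fun setT f ->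
  (forall x, 0 <= f x <= 1) ->
  0 <= \int[mu]_x f x <= 1 /\ (\int[mu]_x (f x)%:E = (\int[mu]_x f x)%R%:E)%E.
Proof.
move=> mu1 mf f01.
have fi : mu.-integrable setT (EFin \o f).
  apply: (@probability_bounded_integrable _ _ _ _ _ 1) => // x.
  by have /andP[? ?] := f01 x; rewrite ger0_norm.
have ci : mu.-integrable setT (EFin \o (fun=> 1 : R)).
  by apply: (@probability_bounded_integrable _ _ _ _ _ 1) => // x; rewrite normr1.
split; last exact: integral_EFin_Rintegral.
apply/andP; split.
  by apply: Rintegral_ge0 => x _; have /andP[] := f01 x.
rewrite -[leRHS](Rintegral_cst1 1 mu1); apply: le_Rintegral => // x _.
by have /andP[] := f01 x.
Qed.

Lemma pol_evalE (f : XA -> R) x : measurable_fun setT f -> unit_valued f ->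
  0 <= pol_eval f pi x <= 1 /\ policy_mean (EFin \o f) x = (pol_eval f pi x)%:E.
Proof.
move=> mf f01; apply: Rintegral_unit => [| |a]; last exact: f01.
  exact: prob_kernel.
exact: measurableT_comp mf _.
Qed.

Section difference.
Variables (f : XA -> R) (g : X -> R).
Hypotheses (mf : measurable_fun setT f) (f01 : unit_valued f)
  (mg : measurable_fun setT g) (g01 : unit_valued g).
Local Notation V := (fun z : XA => Num.max (g z.1) (pol_eval f pi z.1)).
Hypotheses (mV : measurable_fun setT V).
Local Notation T := (bellman M pi V).
Hypothesis mT : measurable_fun setT T.

(** The function [\bar f_g] read along [\bar pi]: [g] where [a^+] is played, [f] elsewhere. *)
Let val (z : XA) : R := \1_goalX z.1 * g z.1 + \1_(~` goalX) z.1 * f z.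

Let mval : measurable_fun setT val.
Proof.
apply: measurable_funD; apply: measurable_funM => //; apply: measurableT_comp => //.
  exact: measurable_goal_indic.
exact: measurable_nongoal_indic.
Qed.

Let val01 : unit_valued val.
Proof.
move=> z; rewrite /val nongoal_indicE.
have /andP[? ?] := f01 z; have /andP[? ?] := g01 z.1.
by have /andP[? ?] := @indic_unit R _ goalX z.1; apply/andP; split; nra.
Qed.

Lemma fbar_valueE :
  (fbar_value M pi (f, g))%:E = (\int[init M]_x policy_mean (EFin \o val) x)%E.
Proof.
have E x : policy_mean (EFin \o val) x = (ext_pol_exp M pi x (fbar (f, g) (inX x)))%:E.
  rewrite (pol_evalE x mval val01).2; congr (_%:E); rewrite /ext_pol_exp /fbar /=.
  rewrite /pol_eval /val; case: x => s c; case: asboolP => gx.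
    under eq_Rintegral => a _ do rewrite /= (indic_in _ gx) (@indic_notin _ _ (~` goalX))// mul1r mul0r addr0.
    by rewrite Rintegral_cst1// prob_kernel.
  by apply: eq_Rintegral => a _ /=; rewrite (indic_notin _ gx) (@indic_in _ _ (~` goalX))// mul1r mul0r add0r.
have [mp p0] := posop_nonneg (posop_policy_mean pi) (nonneg_measurable_EFin mval (fun z => (andP (val01 z)).1)).
have mext : measurable_fun setT (fun x => ext_pol_exp M pi x (fbar (f, g) (inX x))).
  apply/measurable_EFinP; rewrite (_ : _ \o _ = policy_mean (EFin \o val))//.
  by apply/funext => x; rewrite E.
have ext01 x : 0 <= ext_pol_exp M pi x (fbar (f, g) (inX x)) <= 1.
  rewrite -2!lee_fin -E (pol_evalE x mval val01).2 !lee_fin.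
  exact: (pol_evalE x mval val01).1.
have [_ <-] := Rintegral_unit (probability_setT (init M)) mext ext01.
by apply: eq_integral => x _; rewrite E.
Qed.

(** The maximum dominates both cases, so the sampled target need not know whether the next state is
    a goal, which the dynamics data do not record. *)
Let pol_eval_val_le x : pol_eval val pi x <= Num.max (g x) (pol_eval f pi x).
Proof.
rewrite /pol_eval /val; have [gx|gx] := pselect (goalX x).
  under eq_Rintegral => a _ do
    rewrite /= (indic_in _ gx) (@indic_notin _ _ (~` goalX))// mul1r mul0r addr0.
  by rewrite Rintegral_cst1 ?le_max ?lexx//; exact: prob_kernel.
under eq_Rintegral => a _ do
  rewrite /= (indic_notin _ gx) (@indic_in _ _ (~` goalX))// mul1r mul0r add0r.
by rewrite le_max lexx orbT.
Qed.

Lemma dstep_val_le z : (dstep (EFin \o val) z <= (\1_(~` goalX) z.1 * T z)%:E)%E.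
Proof.
have mVx : measurable_fun setT (fun x : X => V (x, point)).
  exact: measurableT_comp mV _.
have V01 x : 0 <= V (x, point) <= 1.
  have /andP[? ?] := g01 x; have /andP[? ?] := (pol_evalE x mf f01).1.
  by rewrite /= le_max ge_max; apply/andP; split; [apply/orP; left|apply/andP].
have pV : pol_eval V pi = (fun x => V (x, point)).
  by apply/funext => x; rewrite /pol_eval /= Rintegral_cst1//; exact: prob_kernel.
have [_ mpol] := pol_evalE z.1 mval val01.
rewrite /dstep /step muleCA EFinM; apply: lee_wpmul2l.
  by rewrite lee_fin; have /andP[] := @indic_unit R _ (~` goalX) z.1.
rewrite /bellman EFinM; apply: lee_wpmul2l; first by rewrite lee_fin discount_ge0.
rewrite pV.
have mS : measurable_fun setT (fun s : S => V (((s, z.1.2) : X), point)).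
  by apply: (measurableT_comp mVx); apply: measurable_fun_pair.
have [_ <-] := @Rintegral_unit _ _ (next_state M z) (fun s : S => V (((s, z.1.2) : X), point))
  (prob_kernel (s := next_state M) z) mS (fun s => V01 (s, z.1.2)).
have [mp p0] := posop_nonneg (posop_policy_mean pi)
  (nonneg_measurable_EFin mval (fun z => (andP (val01 z)).1)).
apply: ge0_le_integral => //.
- by apply: (measurableT_comp mp); apply: measurable_fun_pair.
- exact/measurable_EFinP.
- move=> s _; rewrite (pol_evalE (s, z.1.2) mval val01).2 lee_fin.
  exact: (pol_eval_val_le (s, z.1.2)).
Qed.

(** The sum of [val] and the resolvent of the error [e] is a supersolution for the goal indicator,
    hence bounds its resolvent, the Q-function. The AM-GM remainders are multiplied by the mass off
    the goal, at most [1 / (1 - gamma)], and by the mass on the goal, at most 1. *)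
Lemma performance_difference (lam lam' : R) : 0 < lam -> 0 < lam' ->
  (Jval M pi <= (fbar_value M pi (f, g))%:E +
    ((lam / 2)%:E * sqnorm (occ_notin M pi) (fun z => f z - T z)%R +
     ((2 * lam)^-1 / (1 - gamma))%:E +
     (lam' / 2)%:E * sqnorm (occ_in M pi) (fun x => g x - reward M (inX x))%R +
     ((2 * lam')^-1)%:E))%E.
Proof.
move=> lam0 lam'0.
pose D z := (f z - T z) ^+ 2.
pose G z := (g z - reward M (inX z)) ^+ 2.
have mD : measurable_fun setT D by apply: measurable_funX; exact: measurable_funB.
have mG : measurable_fun setT G.
  apply: measurable_funX; apply: measurable_funB => //.
  by rewrite (_ : (fun x => _) = \1_goalX); [exact: measurable_goal_indic|apply/funext => x; rewrite reward_inX].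
have pv := posop_value M pi.
have D0 z : 0 <= D z by exact: sqr_ge0.
have G0 z : 0 <= G z by exact: sqr_ge0.
pose t1 (z : XA) : \bar R := ((\1_(~` goalX) z.1)%:E * (D z)%:E)%E.
pose t2 (z : XA) : \bar R := ((\1_(~` goalX) z.1)%:E)%E.
pose t3 (z : XA) : \bar R := ((\1_goalX z.1)%:E * (G z.1)%:E)%E.
pose t4 (z : XA) : \bar R := ((\1_goalX z.1)%:E)%E.
pose e z := ((lam / 2)%:E * t1 z + (2 * lam)^-1%:E * t2 z +
             ((lam' / 2)%:E * t3 z + (2 * lam')^-1%:E * t4 z))%E.
have n1 : nonneg_measurable t1.
  apply: (@nonneg_measurable_EFin _ _ _ (fun z : XA => \1_(~` goalX) z.1 * D z)).
    apply: measurable_funM => //; apply: measurableT_comp => //.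
    exact: measurable_nongoal_indic.
  by move=> z; rewrite mulr_ge0// indicE.
have n3 : nonneg_measurable t3.
  apply: (@nonneg_measurable_EFin _ _ _ (fun z : XA => \1_goalX z.1 * G z.1)).
    apply: measurable_funM => //; apply: measurableT_comp => //.
    exact: measurable_goal_indic.
  by move=> z; rewrite mulr_ge0// indicE.
have [l1 l2 l3 l4] : [/\ 0 <= lam / 2, 0 <= (2 * lam)^-1, 0 <= lam' / 2 & 0 <= (2 * lam')^-1].
  by split; rewrite ?invr_ge0 ?divr_ge0 ?mulr_ge0// ltW.
have nc (c : R) t : 0 <= c -> nonneg_measurable t -> nonneg_measurable (fun z : XA => c%:E * t z)%E.
  exact: nonneg_measurable_scale.
have n12 : nonneg_measurable (fun z => (lam / 2)%:E * t1 z + (2 * lam)^-1%:E * t2 z)%E.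
  by apply: nonneg_measurable_add; exact: nc.
have n34 : nonneg_measurable (fun z => (lam' / 2)%:E * t3 z + (2 * lam')^-1%:E * t4 z)%E.
  by apply: nonneg_measurable_add; exact: nc.
have ne : nonneg_measurable e by exact: nonneg_measurable_add.
have nval : nonneg_measurable (EFin \o val).
  exact: (nonneg_measurable_EFin mval (fun z => (andP (val01 z)).1)).
have amgm (l x : R) : 0 < l -> x <= l / 2 * x ^+ 2 + (2 * l)^-1.
  move=> l0; rewrite -subr_ge0.
  have -> : l / 2 * x ^+ 2 + (2 * l)^-1 - x = (2 * l)^-1 * (l * x - 1) ^+ 2.
    by field; rewrite gt_eqF.
  by rewrite mulr_ge0 ?sqr_ge0// invr_ge0 mulr_ge0// ltW.
(* On the goal the continuation is killed and the residual is [1 - g]; off the goal it is at most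
   [T - f]. Only these signs of the errors count. *)
have local_step z : ((\1_goalX z.1)%:E + dstep (EFin \o val) z <= (val z)%:E + e z)%E.
  apply: (le_trans (leeD2l _ (dstep_val_le z))).
  rewrite /e /t1 /t2 /t3 /t4 -!EFinM -!EFinD lee_fin /D /G reward_inX /val.
  have [gz|gz] := pselect (goalX z.1).
    rewrite (indic_in _ gz) (@indic_notin _ _ (~` goalX))//.
    by have := amgm lam' (1 - g z.1) lam'0; rewrite (_ : (1 - g z.1) ^+ 2 = (g z.1 - 1) ^+ 2); [lra|ring].
  rewrite (indic_notin _ gz) (@indic_in _ _ (~` goalX))//.
  by have := amgm lam (T z - f z) lam0; rewrite (_ : (T z - f z) ^+ 2 = (f z - T z) ^+ 2); [lra|ring].
have pr := posop_resolvent (posop_dstep M pi).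
have nRe := posop_nonneg pr ne.
have Res_le z : (resolvent dstep t4 z <= (val z)%:E + resolvent dstep e z)%E.
  apply: (resolvent_le (posop_dstep M pi) m1goal (nonneg_measurable_add nval nRe)) => {}z.
  rewrite (posop_add (posop_dstep M pi) nval nRe) addeA.
  apply: (le_trans (leeD2r _ (local_step z))).
  by rewrite -addeA -(resolventE (posop_dstep M pi) ne).
have pI : positive_operator (fun w (_ : unit) => \int[init M]_x policy_mean w x)%E.
  exact: (posop_comp (posop_policy_mean pi) (posop_integral (init M))).
rewrite Jval_value fbar_valueE.
apply: (le_trans (posop_le pI (posop_nonneg pr m1goal) (nonneg_measurable_add nval nRe) Res_le tt)).
rewrite (posop_add pI nval nRe tt) /=; apply: leeD2l.
rewrite -[leLHS]/((fun=> value e) tt) (posop_add pv n12 n34 tt).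
rewrite (posop_add pv (nc _ _ l1 n1) (nc _ _ l2 m1ngoal) tt).
rewrite (posop_add pv (nc _ _ l3 n3) (nc _ _ l4 m1goal) tt).
rewrite (posop_scale pv l1 n1 tt) (posop_scale pv l2 m1ngoal tt).
rewrite (posop_scale pv l3 n3 tt) (posop_scale pv l4 m1goal tt).
rewrite -!addeA; apply: leeD.
  by apply: lee_wpmul2l; [rewrite lee_fin|exact: value_le_occ_notin].
apply: leeD.
  rewrite EFinM; apply: lee_wpmul2l; [by rewrite lee_fin|exact: value_nongoal_le].
apply: leeD.
  by apply: lee_wpmul2l; [rewrite lee_fin|exact: value_le_occ_in].
rewrite -[leRHS]mule1; apply: lee_wpmul2l; [by rewrite lee_fin|exact: value_goal_le1].
Qed.

End difference.
End performance.

(** * The true value as a fixed point of the sampled operator *)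

Section bellman_optimality.
Context {R : realType} {dS dA dC : measure_display} {S : measurableType dS}
  {A : measurableType dA} {C : measurableType dC} (M : cgo R S A C).
Local Notation X := (S * C)%type.
Local Notation XA := (S * C * A)%type.
Local Notation gamma := (discount M).
Local Notation goalX := (goalX M).
Variable pi : R.-pker X ~> A.
Local Notation Q := (fun z : XA => fine (Qfun M pi (inX z.1) z.2)).
Local Notation rew := (fun x : X => reward M (inX x)).
Local Notation V := (fun z : XA => Num.max (rew z.1) (pol_eval Q pi z.1)).
(* [Q] itself is no fixed point of the sampled Bellman operator, which ignores
   the goal set: [Q = 1] on [G].  The backup of [max(R, Q)] is one, and agrees
   with [Q] off [G]. *)
Local Notation Qt := (bellman M pi V).
Hypotheses (mQ : measurable_fun setT Q) (mV : measurable_fun setT V)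
  (mQt : measurable_fun setT Qt) (Qt01 : unit_valued Qt).

Let QE z : (Q z)%:E = resolvent (dstep M pi) (fun z => (\1_goalX z.1)%:E) z.
Proof.
case: z => x a; rewrite /= Qfun_resolvent fineK// ge0_fin_numE.
  by apply: le_lt_trans (resolvent_goal_le1 _ _ _) _; rewrite ltry.
have pr := posop_resolvent (posop_dstep M pi).
have m1goal : nonneg_measurable (fun z : XA => (\1_goalX z.1)%:E : \bar R).
  apply: nonneg_measurable_EFin => [|z]; last by rewrite indicE.
  by apply: measurableT_comp => //; exact: measurable_goal_indic.
by have [_] := posop_nonneg pr m1goal.
Qed.

Let Q01 : unit_valued Q.
Proof.
move=> z; rewrite -2!lee_fin QE resolvent_goal_le1 andbT.
have pr := posop_resolvent (posop_dstep M pi).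
have m1goal : nonneg_measurable (fun z : XA => (\1_goalX z.1)%:E : \bar R).
  apply: nonneg_measurable_EFin => [|y]; last by rewrite indicE.
  by apply: measurableT_comp => //; exact: measurable_goal_indic.
by have [_] := posop_nonneg pr m1goal.
Qed.

Let Q_step z : (Q z)%:E =
  ((\1_goalX z.1)%:E + dstep M pi (EFin \o Q) z)%E.
Proof.
have m1goal : nonneg_measurable (fun z : XA => (\1_goalX z.1)%:E : \bar R).
  apply: nonneg_measurable_EFin => [|y]; last by rewrite indicE.
  by apply: measurableT_comp => //; exact: measurable_goal_indic.
rewrite QE (resolventE (posop_dstep M pi) m1goal); congr (_ + dstep M pi _ _)%E.
by apply/funext => y /=; rewrite QE.
Qed.

Let Q_goal x a : goalX x -> Q (x, a) = 1.
Proof.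
move=> gx; apply/EFin_inj; rewrite Q_step /dstep /step /=.
by rewrite (indic_in _ gx) (@indic_notin _ _ (~` goalX))// mul0e mule0 adde0.
Qed.

Let polQ01 x : 0 <= pol_eval Q pi x <= 1.
Proof. exact: (pol_evalE pi x mQ Q01).1. Qed.

(** On the goal both arguments of the maximum equal 1; elsewhere the reward is 0. *)
Let V_pol_eval z : V z = pol_eval Q pi z.1.
Proof.
rewrite /= reward_inX; have [gz|gz] := pselect (goalX z.1).
  rewrite (indic_in _ gz) /pol_eval (_ : \int[_]_a _ = 1) ?maxxx//.
  under eq_Rintegral => a _ do rewrite (Q_goal a gz).
  by rewrite Rintegral_cst1//; exact: prob_kernel.
rewrite (indic_notin _ gz); apply/max_idPr.
by have /andP[] := polQ01 z.1.
Qed.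

Let pol_eval_V x : pol_eval V pi x = pol_eval Q pi x.
Proof.
rewrite [LHS]/pol_eval.
under eq_Rintegral => a _ do rewrite V_pol_eval /=.
by rewrite Rintegral_cst1//; exact: prob_kernel.
Qed.

Let Qt_off_goal x a : ~ goalX x -> Qt (x, a) = Q (x, a).
Proof.
move=> gx; apply/EFin_inj; rewrite Q_step /dstep /step /=.
rewrite (indic_notin _ gx) (@indic_in _ _ (~` goalX))// mul1e add0e.
rewrite /bellman /= EFinM; congr (_ * _)%E.
have mpol : measurable_fun setT (pol_eval Q pi).
  rewrite (_ : pol_eval Q pi = (fun x => V (x, point))); last first.
    by apply/funext => y; rewrite V_pol_eval.
  exact: measurableT_comp mV _.
have -> : (fun s' => pol_eval V pi (s', x.2)) = (fun s' => pol_eval Q pi (s', x.2)).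
  by apply/funext => s'; rewrite pol_eval_V.
have mS : measurable_fun setT (fun s : S => pol_eval Q pi (s, x.2)).
  by apply: (measurableT_comp mpol); apply: measurable_fun_pair.
have [_ <-] := Rintegral_unit (prob_kernel (s := next_state M) (x, a)) mS
  (fun s => polQ01 (s, x.2)).
by apply: eq_integral => s _; rewrite (pol_evalE pi (s, x.2) mQ Q01).2.
Qed.

(** On the goal the reward 1 dominates [Qt <= 1]; off the goal [Qt] is [Q]. Whatever [Qt] does on
    the goal is thus hidden by the maximum. *)
Let max_Qt x : Num.max (rew x) (pol_eval Qt pi x) = pol_eval Q pi x.
Proof.
rewrite -[RHS](V_pol_eval (x, point)) /= reward_inX.
have [gx|gx] := pselect (goalX x).
  have /andP[_ ?] := (pol_evalE pi x mQt Qt01).1.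
  have /andP[_ ?] := polQ01 x.
  by rewrite (indic_in _ gx) !(max_idPl _).
congr Num.max; rewrite /pol_eval.
by under eq_Rintegral => a _ do rewrite (Qt_off_goal a gx).
Qed.

Lemma bellman_fixpoint :
  bellman M pi (fun z => Num.max (rew z.1) (pol_eval Qt pi z.1)) = Qt.
Proof.
congr (bellman M pi _); apply/funext => z.
by rewrite max_Qt V_pol_eval.
Qed.

(** [Qt] and [Q] can differ on the goal only, and there [ext_pol_exp] plays [a^+] and reads the
    reward 1. *)
Lemma fbar_value_Jval : (fbar_value M pi (Qt, rew))%:E = Jval M pi.
Proof.
have ext x : ext_pol_exp M pi x (fbar (Qt, rew) (inX x)) = pol_eval Q pi x.
  rewrite -max_Qt /ext_pol_exp /fbar /= reward_inX.
  case: asboolP => gx.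
    rewrite -surjective_pairing (indic_in _ gx).
    have /andP[_ ?] := (pol_evalE pi x mQt Qt01).1.
    by rewrite (max_idPl _).
  rewrite -surjective_pairing (indic_notin _ gx); apply/esym.
  rewrite (max_idPr _); first by [].
  by have /andP[] := (pol_evalE pi x mQt Qt01).1.
have mpol : measurable_fun setT (pol_eval Q pi).
  rewrite (_ : pol_eval Q pi = (fun x => V (x, point))); last first.
    by apply/funext => y; rewrite V_pol_eval.
  exact: measurableT_comp mV _.
rewrite /fbar_value; under eq_Rintegral => x _ do rewrite ext.
have [_ <-] := Rintegral_unit (probability_setT (init M)) mpol polQ01.
apply: eq_integral => x _; rewrite -(pol_evalE pi x mQ Q01).2.
apply: eq_integral => a _; apply: (etrans (QE (x, a))).
by rewrite Qfun_resolvent.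
Qed.

End bellman_optimality.

(** * Bellman errors on the combined data *)

Section sampled_bellman_error.
Context {R : realType} {dS dA dC : measure_display} {S : measurableType dS}
  {A : measurableType dA} {C : measurableType dC} (M : cgo R S A C).
Local Notation X := (S * C)%type.
Local Notation XA := (S * C * A)%type.
Local Notation gamma := (discount M).
Variables (mu_dyn : probability (S * A * S)%type R) (mu_goal : probability X R).

Definition backup (V : X -> R) (z : XA) : R :=
  gamma * \int[trans M (z.1.1, z.2)]_s' V (s', z.1.2).

Lemma bellman_backup (pi : R.-pker X ~> A) (V : X -> R) :
  bellman M pi (fun z => V z.1) = backup V.
Proof.
apply/funext => z; congr (_ * _); apply: eq_Rintegral => s' _.
by rewrite /pol_eval /= Rintegral_cst1//; exact: prob_kernel.
Qed.

(** The excess squared loss of [f] over the regression function [backup V], for one dynamics sample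
    and one goal sample, of which only the context is read. *)
Definition excess (f : XA -> R) (V : X -> R) (zx : S * A * S * X) : R :=
  let y := gamma * V (zx.1.2, zx.2.2) in
  let b := ((zx.1.1.1, zx.2.2), zx.1.1.2) in
  (f b - y) ^+ 2 - (backup V b - y) ^+ 2.

(** The mean squared error at one context. The argument is a whole goal sample, so that averaging
    over [mu_goal] gives the norm under [mu_dyn_prod]. *)
Definition context_error (f : XA -> R) (V : X -> R) (x : X) : R :=
  \int[mu_dyn]_z
    (f ((z.1.1, x.2), z.1.2) - backup V ((z.1.1, x.2), z.1.2)) ^+ 2.

Section fixed_functions.
Variables (f : XA -> R) (V : X -> R).
Hypotheses (mf : measurable_fun setT f) (f01 : unit_valued f)
  (mV : measurable_fun setT V) (V01 : unit_valued V)
  (mT : measurable_fun setT (backup V)).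

Let gamma01 : 0 <= gamma <= 1.
Proof. by rewrite discount_ge0 ltW// discount_lt1. Qed.

Let section_unit z : 0 <= \int[trans M (z.1.1, z.2)]_s' V (s', z.1.2) <= 1.
Proof.
have mS : measurable_fun setT (fun s : S => V (s, z.1.2)).
  by apply: (measurableT_comp mV); apply: measurable_fun_pair.
exact: (Rintegral_unit (prob_kernel (s := trans M) (z.1.1, z.2)) mS
  (fun s => V01 (s, z.1.2))).1.
Qed.

Lemma backup_unit : unit_valued (backup V).
Proof.
move=> z; have /andP[? ?] := section_unit z; have /andP[? ?] := gamma01.
rewrite /backup; apply/andP; split; [exact: mulr_ge0|exact: mulr_ile1].
Qed.

Let glue (w : S * A * S * X) : XA := ((w.1.1.1, w.2.2), w.1.1.2).

Let measurable_glue : measurable_fun setT glue.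
Proof.
apply: measurable_fun_pair; first apply: measurable_fun_pair.
- exact: (measurableT_comp measurable_fst (measurableT_comp measurable_fst measurable_fst)).
- exact: (measurableT_comp measurable_snd measurable_snd).
- exact: (measurableT_comp measurable_snd (measurableT_comp measurable_fst measurable_fst)).
Qed.

Lemma measurable_excess : measurable_fun setT (excess f V).
Proof.
have my : measurable_fun setT (fun w : S * A * S * X => gamma * V (w.1.2, w.2.2)).
  apply: measurable_funM => //; apply: (measurableT_comp mV).
  apply: measurable_fun_pair.
    exact: (measurableT_comp measurable_snd measurable_fst).
  exact: (measurableT_comp measurable_snd measurable_snd).
apply: measurable_funB; apply: measurable_funX; apply: measurable_funB => //.
  exact: (measurableT_comp mf measurable_glue).
exact: (measurableT_comp mT measurable_glue).
Qed.

Let at_context (x : X) (sa : S * A) : XA := ((sa.1, x.2), sa.2).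

Let measurable_at_context x : measurable_fun setT (at_context x).
Proof. by apply: measurable_fun_pair => //; apply: measurable_fun_pair. Qed.

(** Once the context [c] is fixed, [dyn_consistent] makes [backup V] the conditional mean of the
    target [gamma * V (s', c)], as [excess_mgf_le1] requires. *)
Lemma excess_context_mgf_le1 (x : X) : dyn_consistent M mu_dyn ->
  (\int[mu_dyn]_z (expR (- excess f V (z, x) / 8 + context_error f V x / 16))%:E
   <= 1)%E.
Proof.
move=> dis; have /andP[g0 g1] := gamma01.
have mS : measurable_fun setT (fun s : S => V (s, x.2)).
  by apply: (measurableT_comp mV); apply: measurable_fun_pair.
have := @excess_mgf_le1 _ _ _ _ _ (trans M) mu_dyn (f \o at_context x)
  (backup V \o at_context x) (fun s => gamma * V (s, x.2)) dis
  (measurableT_comp mf (measurable_at_context x))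
  (measurableT_comp mT (measurable_at_context x)).
move=> H; apply: le_trans (H _ _ _ _ _).
- rewrite le_eqVlt; apply/orP; left; apply/eqP; apply: eq_integral => z _.
  by rewrite /excess /= opprB.
- exact: measurable_funM.
- by move=> sa; exact: f01.
- by move=> sa; exact: backup_unit.
- by move=> s; have /andP[? ?] := V01 (s, x.2); apply/andP; split; [exact: mulr_ge0|exact: mulr_ile1].
- move=> sa; rewrite RintegralZl//=; last first.
    apply: (@probability_bounded_integrable _ _ _ _ _ 1) => //.
      exact: prob_kernel.
    by move=> s; have /andP[? ?] := V01 (s, x.2); rewrite ger0_norm.
  by rewrite /backup /= -surjective_pairing.
Qed.

Let D (z : XA) : R := (f z - backup V z) ^+ 2.

Let mD : measurable_fun setT D.
Proof. by apply: measurable_funX; exact: measurable_funB. Qed.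

Let D01 : unit_valued D.
Proof.
move=> z; have /andP[? ?] := f01 z; have /andP[? ?] := backup_unit z.
by rewrite /D sqr_ge0/=; nra.
Qed.

Let context_errorE x : (0 <= context_error f V x <= 1) /\
  (\int[mu_dyn]_z (D (glue (z, x)))%:E = (context_error f V x)%:E)%E.
Proof.
apply: (@Rintegral_unit _ _ _ mu_dyn (fun z => D (glue (z, x)))).
- exact: probability_setT.
- by apply: (measurableT_comp mD); apply: (measurableT_comp measurable_glue); apply: measurable_fun_pair.
- by move=> z; exact: D01.
Qed.

Lemma context_error_unit : unit_valued (context_error f V).
Proof. by move=> x; exact: (context_errorE x).1. Qed.

Let mDglue : measurable_fun setT (fun w => (D (glue w))%:E).
Proof. by apply/measurable_EFinP; exact: (measurableT_comp mD measurable_glue). Qed.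

Let Dglue0 w : (0 <= (D (glue w))%:E)%E.
Proof. by rewrite lee_fin sqr_ge0. Qed.

Lemma measurable_context_error : measurable_fun setT (context_error f V).
Proof.
apply/measurable_EFinP.
rewrite (_ : _ \o _ = (fun x => \int[mu_dyn]_z (D (glue (z, x)))%:E)%E).
  exact: (measurable_fun_fubini_tonelli_G (m1 := mu_dyn) _ mDglue Dglue0).
by apply/funext => x; rewrite (context_errorE x).2.
Qed.

Lemma sqnorm_mu_dyn_prod :
  sqnorm (mu_dyn_prod mu_dyn mu_goal) (fun z => f z - backup V z) =
  (\int[mu_goal]_x context_error f V x)%:E.
Proof.
transitivity (\int[(mu_dyn \x mu_goal)%E]_w (D (glue w))%:E)%E.
  rewrite /sqnorm /mu_dyn_prod.
  rewrite (@ge0_integral_pushforward _ _ _ _ _ _ measurable_glue _ setT (fun z => (D z)%:E))//.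
    exact/measurable_EFinP.
  by move=> z _; rewrite lee_fin sqr_ge0.
rewrite fubini_tonelli2//=; under eq_integral => x _ do rewrite /fubini_G /= (context_errorE x).2.
by have [_ ->] := Rintegral_unit (probability_setT mu_goal) measurable_context_error
  context_error_unit.
Qed.

End fixed_functions.

(** Both losses regress on the same target, that of [u], so they differ by a sum of excesses over
    all pairs. *)
Lemma loss_dyn_excess (pi : R.-pker X ~> A) (n m : nat) (Ddyn : 'I_n -> S * A * S)
    (Dgoal : 'I_m -> X) (f : XA -> R) (g : X -> R) (u : (XA -> R) * (X -> R)) :
  let V x := Num.max (u.2 x) (pol_eval u.1 pi x) in
  let D := aug_dyn [seq Ddyn i | i : 'I_n] [seq Dgoal j | j : 'I_m] in
  (n%:R * m%:R)^-1 * \sum_k \sum_j excess f V (Ddyn k, Dgoal j) =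
  loss_dyn M D (f, g) u pi - loss_dyn M D (backup V, g) u pi.
Proof.
move=> V D; have sD : (size D)%:R = n%:R * m%:R :> R.
  by rewrite /D /aug_dyn size_allpairs !size_image !card_ord natrM.
have sumD (h : X * A * R * X -> R) : \sum_(w <- D) h w =
    \sum_k \sum_j h (((Ddyn k).1.1, (Dgoal j).2), (Ddyn k).1.2, 0, ((Ddyn k).2, (Dgoal j).2)).
  rewrite /D /aug_dyn big_allpairs_dep /= big_image /=; apply: eq_bigr => k _.
  by rewrite big_image.
rewrite /loss_dyn sD !sumD -mulrBr; congr (_ * _).
by rewrite -sumrB; apply: eq_bigr => k _; rewrite -sumrB.
Qed.

End sampled_bellman_error.

(** * Uniform concentration over the finite classes *)

Lemma card_set_fset (T : Type) (B : set T) :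
  #|{: fset_set (B : set {classic T})}| = card_set B.
Proof. by rewrite -cardfE. Qed.

Lemma mem_fset_set (T : Type) (B : set T) (x : T) : finite_set B -> B x ->
  (x : {classic T}) \in fset_set (B : set {classic T}).
Proof. by move=> fB Bx; rewrite in_fset_set//; exact: mem_set. Qed.

Lemma card_set_gt0 (T : Type) (B : set T) (x : T) : finite_set B -> B x ->
  (0 < card_set B)%N.
Proof.
by move=> fB Bx; rewrite -card_set_fset; apply/card_gt0P; exists [` mem_fset_set fB Bx]%fset.
Qed.

Lemma mem_fset_setW (T : Type) (B : set T) (x : fset_set (B : set {classic T})) :
  finite_set B -> B (fsval x).
Proof.
move=> fB; suff /set_mem : (fsval x : T) \in B by [].
by rewrite -(@in_fset_set {classic T} B)// fsvalP.
Qed.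

Section class_concentration.
Context {R : realType} {dS dA dC dO : measure_display} {S : measurableType dS}
  {A : measurableType dA} {C : measurableType dC} {Om : measurableType dO}
  (M : cgo R S A C).
Local Notation X := (S * C)%type.
Local Notation XA := (S * C * A)%type.
Local Notation policy := (R.-pker (S * C)%type ~> A).
Variables (mu_dyn : probability (S * A * S)%type R) (mu_goal : probability X R)
  (F : set (XA -> R)) (G : set (X -> R)) (Pi : set policy).
Hypotheses (adm : admissible_classes F G Pi) (compl : completeness M F G Pi).

Definition greedy_value (f : XA -> R) (g : X -> R) (pi : policy) (x : X) : R :=
  Num.max (g x) (pol_eval f pi x).

Section members.
Variables (f : XA -> R) (g : X -> R) (pi : policy).
Hypotheses (Ff : F f) (Gg : G g) (Ppi : Pi pi).

Lemma measurable_greedy_value : measurable_fun setT (greedy_value f g pi).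
Proof.
have [_ _ _ FP _] := adm; have [/FP[mW _] _] := compl Ff Gg Ppi.
have mp : measurable_fun setT (fun x : X => (x, point : A)) by exact: measurable_fun_pair.
exact: (measurableT_comp mW mp).
Qed.

Lemma greedy_value_unit : unit_valued (greedy_value f g pi).
Proof.
have [_ _ _ FP _] := adm; have [/FP[_ W01] _] := compl Ff Gg Ppi.
by move=> x; exact: (W01 (x, point)).
Qed.

(** Completeness is used twice: for the maximum, then for its Bellman image. *)
Lemma backup_greedy_value_in : F (backup M (greedy_value f g pi)).
Proof.
have [FW _] := compl Ff Gg Ppi; rewrite -(bellman_backup M pi).
by have [] := compl FW Gg Ppi.
Qed.

End members.

Lemma class_concentration (Pr : probability Om R) (n m : nat)
    (Ddyn : 'I_n -> Om -> S * A * S) (Dgoal : 'I_m -> Om -> X) (delta : R) :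
  dyn_consistent M mu_dyn -> goal_consistent M mu_goal ->
  (0 < card_set F)%N -> (0 < card_set G)%N -> (0 < card_set Pi)%N ->
  (0 < n)%N -> (0 < m)%N -> iid_samples mu_dyn mu_goal Pr Ddyn Dgoal -> 0 < delta ->
  exists E : set Om, [/\ measurable E, ((1 - delta)%:E <= Pr E)%E &
    forall w, E w ->
    let LI := ln (3 * (card_set F * card_set F * card_set G * card_set Pi)%:R / delta) in
    let LJ := ln (3 * (card_set G)%:R / delta) in
    let DD := aug_dyn [seq Ddyn i w | i : 'I_n] [seq Dgoal j w | j : 'I_m] in
    [/\ forall f f' g pi, F f -> F f' -> G g -> Pi pi ->
          (\int[mu_goal]_x context_error M mu_dyn f (greedy_value f' g pi) x) / 4
            - LI / m%:R - 8 * (LI / n%:R) <=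
          loss_dyn M DD (f, g) (f', g) pi -
          loss_dyn M DD (backup M (greedy_value f' g pi), g) (f', g) pi,
        forall g, G g -> (\int[mu_goal]_x (g x - reward M (inX x)) ^+ 2) / 2
            - 2 * (LJ / m%:R) <=
          m%:R^-1 * \sum_j (g (Dgoal j w) - reward M (inX (Dgoal j w))) ^+ 2 &
        forall j, goalX M (Dgoal j w)]].
Proof.
move=> dis gcons F0 G0 P0 n0 m0 iid d0; have [fF fG fP FP GP] := adm.
pose FF := fset_set (F : set {classic (XA -> R)}).
pose FG := fset_set (G : set {classic (X -> R)}).
pose FPi := fset_set (Pi : set {classic policy}).
(* The predictor [f] and the target given by [(f', g, pi)] range independently, because feasibility
   compares all predictors for one target; hence [card_set F] appears squared. *)
pose I := (FF * FF * FG * FPi)%type.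
have cI : #|{: I}| = (card_set F * card_set F * card_set G * card_set Pi)%N.
  by rewrite !card_prod !card_set_fset.
have cJ : #|{: FG}| = card_set G by exact: card_set_fset.
pose f_ (i : I) : XA -> R := fsval i.1.1.1.
pose v_ (i : I) := greedy_value (fsval i.1.1.2) (fsval i.1.2) (fsval i.2).
have Ff i : F (f_ i) by exact: mem_fset_setW.
have mf i : measurable_fun setT (f_ i) /\ unit_valued (f_ i) by exact: FP.
have mv i : measurable_fun setT (v_ i) /\ unit_valued (v_ i).
  split; [apply: measurable_greedy_value|apply: greedy_value_unit]; exact: mem_fset_setW.
have mT i : measurable_fun setT (backup M (v_ i)).
  by apply: (FP _ _).1; apply: backup_greedy_value_in; exact: mem_fset_setW.
have gj (j : FG) : measurable_fun setT (fsval j : X -> R) /\ unit_valued (fsval j : X -> R).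
  by apply: GP; exact: mem_fset_setW.
have mrew : measurable_fun setT (fun x : X => reward M (inX x)).
  by rewrite (_ : (fun x => _) = \1_(goalX M)); [exact: measurable_goal_indic|apply/funext => x; rewrite reward_inX].
have [|||||||||||E [mE PE EP]] := @concentration_event R _ _ _ _ S A C Om mu_dyn mu_goal
  Pr n m Ddyn Dgoal n0 m0 iid I FG (fun i => excess M (f_ i) (v_ i))
  (fun i => context_error M mu_dyn (f_ i) (v_ i))
  (fun j x => ((fsval j : X -> R) x - reward M (inX x)) ^+ 2) (goalX M) delta.
- by rewrite cI !muln_gt0 F0 G0.
- by rewrite cJ.
- exact: d0.
- by move=> i; apply: measurable_excess => //; [exact: (mf i).1|exact: (mv i).1].
- by move=> i; apply: measurable_context_error => //; [exact: (mf i).1|exact: (mf i).2|exact: (mv i).1|exact: (mv i).2].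
- by move=> i; apply: context_error_unit => //; [exact: (mf i).1|exact: (mf i).2|exact: (mv i).1|exact: (mv i).2].
- by move=> i x; apply: excess_context_mgf_le1 => //; [exact: (mf i).1|exact: (mf i).2|exact: (mv i).1|exact: (mv i).2].
- by move=> j; apply: measurable_funX; apply: measurable_funB => //; exact: (gj j).1.
- move=> j x; have /andP[? ?] := (gj j).2 x; rewrite reward_inX sqr_ge0/=.
  by have /andP[? ?] := @indic_unit R _ (goalX M) x; nra.
- exact: measurable_goalX.
- exact: gcons.
exists E; split => // w Ew.
have := EP w Ew; rewrite cI cJ => -[HI HJ HG] LI LJ DD; split => //.
- move=> f f' g pi Hf Hf' Hg Hpi.
  have := HI (([` mem_fset_set fF Hf], [` mem_fset_set fF Hf'], [` mem_fset_set fG Hg],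
    [` mem_fset_set fP Hpi])%fset : I).
  by rewrite (@loss_dyn_excess _ _ _ _ _ _ _ _ _ _ _ _ _ _ g (f', g)).
- move=> g Hg; exact: (HJ [` mem_fset_set fG Hg]%fset).
Qed.

End class_concentration.

(** * Concentrability and change of measure *)

(** The delicate case is [b = 0 < a]: the ratio is [+oo], so [c = +oo], and [0 < r] makes the right
    side infinite too. *)
Lemma ratio_le_mul (R : realType) (a b c : \bar R) (r : R) :
  (0 <= a)%E -> (0 <= b)%E -> (b <= r%:E)%E -> 0 < r -> (0 <= c)%E ->
  (Defs.ratio a b <= c)%E -> (a <= c * r%:E)%E.
Proof.
move=> a0 b0 br r0 c0; rewrite /Defs.ratio.
have bfin : b \is a fin_num by rewrite ge0_fin_numE// (le_lt_trans br)// ltry.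
have [b00|bn0] := eqVneq b 0%E.
  have [->|an0] := eqVneq a 0%E; first by rewrite mule_ge0// lee_fin ltW.
  rewrite /= b00 inve0 gt0_muley; last by rewrite lt_def an0.
  by rewrite leye_eq => /eqP ->; rewrite mulr_infty gtr0_sg// mul1e leey.
rewrite andbF => abc.
have b_gt0 : (0 < b)%E by rewrite lt_def bn0.
apply: (@le_trans _ _ (c * b)%E); last exact: lee_wpmul2l.
case: b {b0 br bn0} bfin b_gt0 abc => // b _; rewrite lte_fin => b_gt0.
by rewrite inver gt_eqF// lee_pdivrMr.
Qed.

Section concentrability.
Context {R : realType} {dS dA dC : measure_display} {S : measurableType dS}
  {A : measurableType dA} {C : measurableType dC} (M : cgo R S A C).
Local Notation X := (S * C)%type.
Local Notation XA := (S * C * A)%type.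
Variable pi : R.-pker X ~> A.

Let value0 (w : XA -> \bar R) : (forall z, w z = 0%E) -> value M pi w = 0%E.
Proof.
move=> w0; have n0 := @nonneg_measurable_cst R _ XA 0 (lexx 0).
rewrite -[RHS](mul0e (value M pi (fun=> 0%E))).
have <- := posop_scale (posop_value M pi) (lexx 0) n0 tt.
by congr value; apply/funext => z; rewrite w0 mule0.
Qed.

Lemma occ_notin_set0 : occ_notin M pi set0 = 0%E.
Proof. by rewrite occ_notin_value//; apply: value0 => z; rewrite indic0 mule0. Qed.

Lemma occ_in_set0 : occ_in M pi set0 = 0%E.
Proof. by rewrite occ_in_value//; apply: value0 => z; rewrite indic0 mule0. Qed.

Lemma sqnorm0 (d : measure_display) (T : measurableType d) (mu : set T -> \bar R)
    (h : T -> R) : mu set0 = 0%E -> (forall z, h z = 0) -> sqnorm mu h = 0%E.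
Proof.
move=> mu0 h0; rewrite /sqnorm -[RHS](integral0_set_function mu0).
by congr integral; apply/funext => z; rewrite h0 expr0n.
Qed.

(** For a set function not packaged as a measure, nonnegativity of the integral is obtained from its
    lower bound by [value]. *)
Lemma sqnorm_occ_notin_ge0 (h : XA -> R) : measurable_fun setT h ->
  (0 <= sqnorm (occ_notin M pi) h)%E.
Proof.
move=> mh; have mh2 : measurable_fun setT (fun z => h z ^+ 2) by exact: measurable_funX.
apply: le_trans (value_le_occ_notin M pi mh2 (fun z => sqr_ge0 _)).
apply: (posop_nonneg (posop_value M pi) _).2 tt.
apply: (@nonneg_measurable_EFin _ _ _ (fun z : XA => \1_(~` goalX M) z.1 * h z ^+ 2)).
  apply: measurable_funM => //; apply: measurableT_comp => //.
  exact: measurable_nongoal_indic.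
by move=> z; rewrite mulr_ge0 ?sqr_ge0// indicE.
Qed.

Lemma sqnorm_occ_in_ge0 (h : X -> R) : measurable_fun setT h ->
  (0 <= sqnorm (occ_in M pi) h)%E.
Proof.
move=> mh; have mh2 : measurable_fun setT (fun z => h z ^+ 2) by exact: measurable_funX.
apply: le_trans (value_le_occ_in M pi mh2 (fun z => sqr_ge0 _)).
apply: (posop_nonneg (posop_value M pi) _).2 tt.
apply: (@nonneg_measurable_EFin _ _ _ (fun z : XA => \1_(goalX M) z.1 * h z.1 ^+ 2)).
  apply: measurable_funM; first by apply: measurableT_comp => //; exact: measurable_goal_indic.
  exact: (measurableT_comp mh2).
by move=> z; rewrite mulr_ge0 ?sqr_ge0// indicE.
Qed.

Variables (mu_dyn : probability (S * A * S)%type R) (mu_goal : probability X R).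

Lemma conc_dyn_ge1 (F : set (XA -> R)) (f : XA -> R) :
  F f -> F (bellman M pi f) -> (1 <= conc_dyn M F mu_dyn mu_goal pi)%E.
Proof.
move=> Ff FT; apply: ereal_sup_ubound; exists (bellman M pi f), f; split => //.
rewrite !sqnorm0 ?occ_notin_set0 /Defs.ratio ?eqxx//; try by move=> z; rewrite subrr.
by rewrite /mu_dyn_prod /pushforward preimage_set0 measure0.
Qed.

Lemma conc_goal_ge1 (G : set (X -> R)) :
  G (fun x => reward M (inX x)) -> (1 <= conc_goal M G mu_goal pi)%E.
Proof.
move=> GR; apply: ereal_sup_ubound; exists (fun x => reward M (inX x)) => //.
by rewrite !sqnorm0 ?occ_in_set0 /Defs.ratio ?eqxx//; move=> z; rewrite subrr.
Qed.

Lemma Jval01 : (0 <= Jval M pi <= 1)%E.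
Proof.
rewrite Jval_value value_goal_le1 andbT.
apply: (posop_nonneg (posop_value M pi) _).2 tt.
apply: nonneg_measurable_EFin => [|z]; last by rewrite indicE.
by apply: measurableT_comp => //; exact: measurable_goal_indic.
Qed.

End concentrability.

(** * Regret of the learned policy on the good event *)

Section regret.
Context {R : realType} {dS dA dC : measure_display} {S : measurableType dS}
  {A : measurableType dA} {C : measurableType dC} (M : cgo R S A C).
Local Notation X := (S * C)%type.
Local Notation XA := (S * C * A)%type.
Local Notation policy := (R.-pker (S * C)%type ~> A).
Local Notation gamma := (discount M).
Local Notation rew := (fun x : X => reward M (inX x)).
Variables (mu_dyn : probability (S * A * S)%type R) (mu_goal : probability X R)
  (F : set (XA -> R)) (G : set (X -> R)) (Pi : set policy).
Hypotheses (adm : admissible_classes F G Pi) (rea : realizability M F G Pi)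
  (compl : completeness M F G Pi).
Variables (n m : nat) (Ddyn : 'I_n -> S * A * S) (Dgoal : 'I_m -> X).
Local Notation DD := (aug_dyn [seq Ddyn i | i : 'I_n] [seq Dgoal j | j : 'I_m]).
Variables (rho rho' K : R).
Hypotheses (rho0 : 0 < rho) (rho'0 : 0 < rho') (K32 : 32 <= K).
Hypothesis dyn_conc : forall f f' g pi, F f -> F f' -> G g -> Pi pi ->
  (\int[mu_goal]_x context_error M mu_dyn f (greedy_value f' g pi) x) / 4
    - 32 * rho ^+ 2 <=
  loss_dyn M DD (f, g) (f', g) pi -
  loss_dyn M DD (backup M (greedy_value f' g pi), g) (f', g) pi.
Hypothesis goal_conc : forall g, G g ->
  (\int[mu_goal]_x (g x - rew x) ^+ 2) / 2 - 6 * rho' ^+ 2 <=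
  m%:R^-1 * \sum_j (g (Dgoal j) - rew (Dgoal j)) ^+ 2.
Hypothesis goal_data : forall j, goalX M (Dgoal j).

Let loss_goalE (u : (XA -> R) * (X -> R)) : loss_goal (aug_goal [seq Dgoal j | j : 'I_m]) u =
  m%:R^-1 * \sum_j (u.2 (Dgoal j) - rew (Dgoal j)) ^+ 2.
Proof.
rewrite /loss_goal /aug_goal size_map size_image card_ord big_map big_image /=.
congr (_ * _); apply: eq_bigr => j _.
by rewrite reward_inX (indic_in _ (goal_data j)).
Qed.

Let loss_dyn_ge0 u v pi : 0 <= loss_dyn M DD u v pi.
Proof.
by rewrite mulr_ge0 ?invr_ge0//; apply: sumr_ge0 => w _; exact: sqr_ge0.
Qed.

Let context_error_mean f f' g pi : F f -> F f' -> G g -> Pi pi ->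
  0 <= \int[mu_goal]_x context_error M mu_dyn f (greedy_value f' g pi) x.
Proof.
move=> Ff Ff' Gg Ppi; have [_ _ _ FP GP] := adm.
have [mf f01] := FP _ Ff.
have mV := measurable_greedy_value adm compl Ff' Gg Ppi.
have V01 := greedy_value_unit adm compl Ff' Gg Ppi.
have [mT _] := FP _ (backup_greedy_value_in compl Ff' Gg Ppi).
apply: Rintegral_ge0 => x _.
by have /andP[] := context_error_unit mu_dyn mf f01 mV V01 mT x.
Qed.

(** As [Qt] is its own backup and errors are nonnegative, [dyn_conc] says that no predictor beats it
    by more than [32 rho^2], which is where [32 <= K] enters. Its goal loss is zero because all goal
    samples lie in the goal set. *)
Lemma true_value_feasible (pi : policy) : Pi pi ->
  exists2 u, feasible M F G [seq Ddyn i | i : 'I_n] [seq Dgoal j | j : 'I_m]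
    (K * rho ^+ 2) pi u & (fbar_value M pi u)%:E = Jval M pi.
Proof.
move=> Ppi; have [_ _ _ FP GP] := adm; have [FQ GR] := rea.
pose Q (z : XA) := fine (Qfun M pi (inX z.1) z.2).
have {}FQ : F Q by exact: FQ.
have [FV _] := compl FQ GR Ppi; have [_ FQt] := compl FV GR Ppi.
pose Qt := bellman M pi (fun z => Num.max (rew z.1) (pol_eval Q pi z.1)).
have [[mQ _] [mV _] [mQt Qt01]] := And3 (FP _ FQ) (FP _ FV) (FP _ FQt).
have fixQt : backup M (greedy_value Qt rew pi) = Qt.
  rewrite -(bellman_backup M pi); exact: (bellman_fixpoint mQ mV mQt Qt01).
exists (Qt, rew); last exact: (fbar_value_Jval mQ mV mQt Qt01).
split; first by split.
- rewrite lerBlDr -lerBlDl; apply: lb_le_inf; first by exists (loss_dyn M DD (Qt, rew) (Qt, rew) pi); exists (Qt, rew).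
  move=> _ [v [Fv _] <-].
  have := dyn_conc Fv FQt GR Ppi; have := context_error_mean Fv FQt GR Ppi.
  rewrite -/Qt fixQt; set c := \int[_]_x _ => c0.
  rewrite -[loss_dyn M DD (v.1, _) _ _]/(loss_dyn M DD v (Qt, rew) pi).
  have : 32 * rho ^+ 2 <= K * rho ^+ 2 by rewrite ler_wpM2r// sqr_ge0.
  move: (rho ^+ 2) (K * _) (loss_dyn _ _ _ _ _) (loss_dyn _ _ _ _ _) => r e a b; lra.
- rewrite loss_goalE /= big1 ?mulr0// => j _.
  by rewrite subrr expr0n.
Qed.

(** The backup competes in the infimum, so a feasible pair loses at most [K rho^2] to it. A quarter
    of the mean error is then at most [(K + 32) rho^2 <= 2 K rho^2]. For [g], the zero loss leaves
    half the mean error below [6 rho'^2]. *)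
Lemma feasible_errors (pi : policy) (f : XA -> R) (g : X -> R) : Pi pi ->
  feasible M F G [seq Ddyn i | i : 'I_n] [seq Dgoal j | j : 'I_m]
    (K * rho ^+ 2) pi (f, g) ->
  (\int[mu_goal]_x context_error M mu_dyn f (greedy_value f g pi) x <= 8 * K * rho ^+ 2) /\
  \int[mu_goal]_x (g x - rew x) ^+ 2 <= 12 * rho' ^+ 2.
Proof.
move=> Ppi [[/= Ff Gg] dyn_feas goal_feas]; split; last first.
  by have := goal_conc Gg; move: goal_feas; rewrite loss_goalE /=; lra.
have FT := backup_greedy_value_in compl Ff Gg Ppi.
have := dyn_conc Ff Ff Gg Ppi.
have : inf [set loss_dyn M DD v (f, g) pi | v in Fbar F G] <=
    loss_dyn M DD (backup M (greedy_value f g pi), g) (f, g) pi.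
  apply: ge_inf; last by exists (backup M (greedy_value f g pi), g).
  by exists 0 => _ [v _ <-]; exact: loss_dyn_ge0.
have : 32 * rho ^+ 2 <= K * rho ^+ 2 by rewrite ler_wpM2r// sqr_ge0.
rewrite -mulrA.
move: dyn_feas; move: (rho ^+ 2) (K * _) (inf _) (loss_dyn _ _ _ _ _) (loss_dyn _ _ _ _ _) => r e i a b; lra.
Qed.

(** [4 K] and 6 are half the constants [8 K] and 12 of [feasible_errors]; [1 / (2 (1 - gamma))] and
    1/2 are AM-GM remainders, and 7 covers 6 + 1/2. *)
Let Cst := 4 * K + (2 * (1 - gamma))^-1 + 7.

Let gamma1 : 0 < (2 * (1 - gamma))^-1.
Proof. by rewrite invr_gt0 mulr_gt0// subr_gt0 discount_lt1. Qed.

Lemma value_le_feasible (pi : policy) (u : (XA -> R) * (X -> R)) : Pi pi ->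
  feasible M F G [seq Ddyn i | i : 'I_n] [seq Dgoal j | j : 'I_m]
    (K * rho ^+ 2) pi u ->
  (Jval M pi <= (fbar_value M pi u)%:E +
    Cst%:E * (conc_dyn M F mu_dyn mu_goal pi * rho%:E +
              conc_goal M G mu_goal pi * rho'%:E))%E.
Proof.
case: u => f g Ppi feas; have [dyn_err goal_err] := feasible_errors Ppi feas.
have [[/= Ff Gg] _ _] := feas; have [_ _ _ FP GP] := adm; have [_ GR] := rea.
have [[mf f01] [mg g01] [mR R01]] := And3 (FP _ Ff) (GP _ Gg) (GP _ GR).
have mV := measurable_greedy_value adm compl Ff Gg Ppi.
have V01 := greedy_value_unit adm compl Ff Gg Ppi.
have FT := backup_greedy_value_in compl Ff Gg Ppi.
have [mT _] := FP _ FT.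
have [FW FTf] := compl Ff Gg Ppi; have [_ FTW] := compl FW Gg Ppi.
have [[mW _] [mTW _]] := conj (FP _ FW) (FP _ FTW).
have TE : bellman M pi (fun z => Num.max (g z.1) (pol_eval f pi z.1)) =
    backup M (greedy_value f g pi) := bellman_backup M pi (greedy_value f g pi).
(* The AM-GM scales [1 / rho] and [1 / rho'] turn squared errors of order [rho^2], [rho'^2] and the
   remainders alike into terms linear in the rates. *)
have [l1 l2] : 0 < rho^-1 /\ 0 < rho'^-1 by rewrite !invr_gt0.
apply: le_trans (performance_difference mf f01 mg g01 mW mTW l1 l2) _.
apply: leeD2l.
have cd1 := conc_dyn_ge1 mu_dyn mu_goal Ff FTf.
have cg1 := conc_goal_ge1 pi mu_goal GR.
have cd0 : (0 <= conc_dyn M F mu_dyn mu_goal pi)%E by exact: le_trans cd1.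
have cg0 : (0 <= conc_goal M G mu_goal pi)%E by exact: le_trans cg1.
have K0 : 0 < K by apply: lt_le_trans K32; rewrite ltr0n.
have sq_dyn : (sqnorm (occ_notin M pi) (fun z => f z - bellman M pi
    (fun z => Num.max (g z.1) (pol_eval f pi z.1)) z)%R <=
    conc_dyn M F mu_dyn mu_goal pi * (8 * K * rho ^+ 2)%:E)%E.
  apply: (@ratio_le_mul _ _ (sqnorm (mu_dyn_prod mu_dyn mu_goal) (fun z => f z - bellman M pi
    (fun z => Num.max (g z.1) (pol_eval f pi z.1)) z))) => //.
  - by apply: sqnorm_occ_notin_ge0; exact: measurable_funB.
  - by rewrite TE sqnorm_mu_dyn_prod// lee_fin context_error_mean.
  - by rewrite TE sqnorm_mu_dyn_prod// lee_fin.
  - by rewrite !mulr_gt0// exprn_gt0.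
  - by apply: ereal_sup_ubound; exists f, (fun z => Num.max (g z.1) (pol_eval f pi z.1)).
have mgR : measurable_fun setT (fun x => g x - rew x) by exact: measurable_funB.
have [gR0 gRE] := @Rintegral_unit _ _ _ mu_goal (fun x => (g x - rew x) ^+ 2)
  (probability_setT mu_goal) (measurable_funX 2 mgR)
  (fun x => ltac:(have /andP[? ?] := g01 x; have /andP[? ?] := R01 x; rewrite sqr_ge0/=; nra)).
have sq_goal : (sqnorm (occ_in M pi) (fun x => g x - rew x)%R <=
    conc_goal M G mu_goal pi * (12 * rho' ^+ 2)%:E)%E.
  apply: (@ratio_le_mul _ _ (sqnorm mu_goal (fun x => g x - rew x))) => //.
  - exact: sqnorm_occ_in_ge0.
  - by rewrite /sqnorm gRE lee_fin; case/andP: gR0.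
  - by rewrite /sqnorm gRE lee_fin.
  - by rewrite mulr_gt0// exprn_gt0.
  - by apply: ereal_sup_ubound; exists g.
have cmul (c : \bar R) (a b : R) : (1 <= c)%E -> 0 <= b -> b <= a -> (b%:E <= c * a%:E)%E.
  move=> c1 b0 ba; rewrite -[leLHS]mul1e; apply: lee_pmul => //; rewrite lee_fin//.
set cd := conc_dyn _ _ _ _ _ in cd1 cd0 sq_dyn *.
set cg := conc_goal _ _ _ _ in cg1 cg0 sq_goal *.
have [r0 r'0] : 0 <= rho /\ 0 <= rho' by split; exact: ltW.
rewrite [leRHS]ge0_muleDr; [|by rewrite mule_ge0|by rewrite mule_ge0].
rewrite -addeA; apply: leeD.
  apply: (@le_trans _ _ (cd * (4 * K * rho)%:E + cd * ((2 * (1 - gamma))^-1 * rho)%:E)%E).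
    apply: leeD.
      rewrite (_ : (4 * K * rho)%:E = (8 * K * rho ^+ 2)%:E * (rho^-1 / 2)%:E)%E.
        by rewrite muleA [leRHS]muleC lee_wpmul2l// lee_fin divr_ge0// ltW.
      by rewrite -EFinM; congr (_%:E); field; rewrite gt_eqF.
    apply: cmul => //.
      by rewrite divr_ge0 ?subr_ge0 ?invr_ge0 ?mulr_ge0 ?ltW ?discount_lt1.
    rewrite le_eqVlt; apply/orP; left; apply/eqP; field.
    by rewrite !gt_eqF// subr_gt0 discount_lt1.
  rewrite -[leLHS]ge0_muleDr; [|by rewrite lee_fin !mulr_ge0// ltW|by rewrite lee_fin mulr_ge0// ltW].
  rewrite muleCA; apply: lee_wpmul2l => //.
  rewrite -EFinM -EFinD lee_fin -mulrDl ler_pM2r// /Cst; lra.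
apply: (@le_trans _ _ (cg * (6 * rho')%:E + cg * (rho' / 2)%:E)%E).
  apply: leeD.
    rewrite (_ : (6 * rho')%:E = (12 * rho' ^+ 2)%:E * (rho'^-1 / 2)%:E)%E.
      by rewrite muleA [leRHS]muleC lee_wpmul2l// lee_fin divr_ge0// ltW.
    by rewrite -EFinM; congr (_%:E); field; rewrite gt_eqF.
  apply: cmul => //; first by rewrite invr_ge0 mulr_ge0// ltW.
  by rewrite le_eqVlt; apply/orP; left; apply/eqP; field; rewrite gt_eqF.
rewrite -[leLHS]ge0_muleDr; [|by rewrite lee_fin mulr_ge0|by rewrite lee_fin divr_ge0].
rewrite muleCA; apply: lee_wpmul2l => //.
rewrite -EFinM -EFinD lee_fin /Cst.
have : 0 <= (4 * K + (2 * (1 - gamma))^-1) * rho' by rewrite mulr_ge0 ?addr_ge0 ?ltW// mulr_gt0.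
lra.
Qed.

Lemma regret_bound (pid pi : policy) :
  coda_pspi M F G Pi [seq Ddyn i | i : 'I_n] [seq Dgoal j | j : 'I_m]
    (K * rho ^+ 2) pid -> Pi pi ->
  (Jval M pi - Jval M pid <=
    Cst%:E * (conc_dyn M F mu_dyn mu_goal pi * rho%:E +
              conc_goal M G mu_goal pi * rho'%:E))%E.
Proof.
move=> [Ppid opt] Ppi; set err := (Cst%:E * _)%E.
have Jfin p : Jval M p \is a fin_num.
  by have /andP[J0 J1] := Jval01 M p; rewrite ge0_fin_numE// (le_lt_trans J1)// ltry.
(* The bound is [+oo] if a coefficient is infinite. It is not [-oo]: [value_le_feasible] at a
   feasible pair would force [Jval] to be [-oo]. *)
case errE : err => [e| |]; first last.
- have [v feas_v _] := true_value_feasible Ppi.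
  have := value_le_feasible Ppi feas_v; rewrite -/err errE addeNy leeNy_eq => /eqP Jpi.
  by have := Jfin pi; rewrite Jpi.
- exact: leey.
have [u feas_u uJ] := true_value_feasible Ppid.
rewrite leeBlDr//; apply: (@le_trans _ _ (e%:E + pessimistic_value M F G
  [seq Ddyn i | i : 'I_n] [seq Dgoal j | j : 'I_m] (K * rho ^+ 2) pi)%E); last first.
  apply: leeD2l; apply: (le_trans (opt _ Ppi)).
  by rewrite -uJ; apply: ereal_inf_lbound; exists u.
rewrite addeC -leeBlDr//; apply: le_ereal_inf_tmp => _ [v feas_v <-].
by rewrite leeBlDr// -errE; exact: value_le_feasible.
Qed.

End regret.

(** * Cardinalities in the logarithms, and the final bound *)

(** Absorbs the 3 of the concentration event and powers of cardinalities into a constant factor.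
    Since [d < 1], [d ^ k.+1 <= d], so [3 a / d] is at most [(b / d) ^ k.+1]. *)
Lemma ln_tripled_le (R : realType) (a b d : R) (k : nat) :
  0 < a -> 0 < b -> 3 * a <= b ^+ k.+1 -> 0 < d < 1 ->
  ln (3 * a / d) <= k.+1%:R * ln (b / d).
Proof.
move=> a0 b0 ab /andP[d0 d1].
have bd : 0 < b / d by rewrite divr_gt0.
have -> : k.+1%:R * ln (b / d) = ln ((b / d) ^+ k.+1) by rewrite lnXn// mulr_natl.
rewrite ler_ln ?posrE ?exprn_gt0 ?divr_gt0 ?mulr_gt0//.
rewrite expr_div_n; apply: ler_pM => //; [by rewrite mulr_ge0// ltW|by rewrite invr_ge0 ltW|].
rewrite lef_pV2 ?posrE ?exprn_gt0// exprS ger_pMr//.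
by rewrite exprn_ile1// ltW.
Qed.

Lemma card_set_le1_eq (T : Type) (B : set T) (x y : T) :
  finite_set B -> (card_set B <= 1)%N -> B x -> B y -> x = y.
Proof.
move=> fB; rewrite -card_set_fset => /fintype_le1P H Bx By.
by have /(congr1 (@fsval _ _))/esym := H [` mem_fset_set fB Bx]%fset [` mem_fset_set fB By]%fset.
Qed.

Theorem theorem5p4 (R : realType) :
  exists2 K0 : R, 0 < K0 & forall K : R, K0 <= K ->
  forall gamma : R, 0 <= gamma < 1 ->
  exists2 Cst : R, 0 < Cst &
  forall (dS dA dC : measure_display) (S : measurableType dS)
    (A : measurableType dA) (C : measurableType dC) (M : cgo R S A C),
  discount M = gamma ->
  forall (mu_dyn : probability (S * A * S)%type R)
    (mu_goal : probability (S * C)%type R),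
  dyn_consistent M mu_dyn -> goal_consistent M mu_goal ->
  forall (F : set (S * C * A -> R)) (G : set (S * C -> R))
    (Pi : set (R.-pker (S * C)%type ~> A)),
  admissible_classes F G Pi -> realizability M F G Pi -> completeness M F G Pi ->
  forall (dO : measure_display) (Omega : measurableType dO)
    (Pr : probability Omega R) (n m : nat)
    (Ddyn : 'I_n -> Omega -> S * A * S) (Dgoal : 'I_m -> Omega -> S * C),
  (0 < n)%N -> (0 < m)%N -> iid_samples mu_dyn mu_goal Pr Ddyn Dgoal ->
  forall delta : R, 0 < delta < 1 ->
  exists E : set Omega,
    [/\ measurable E, ((1 - delta)%:E <= Pr E)%E &
      forall w, E w ->
      forall pid : R.-pker (S * C)%type ~> A,
      coda_pspi M F G Pi [seq Ddyn i w | i : 'I_n] [seq Dgoal j w | j : 'I_m]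
        (K * rate_dyn F G Pi delta n m ^+ 2) pid ->
      forall pi : R.-pker (S * C)%type ~> A, Pi pi ->
      (Jval M pi - Jval M pid <=
       Cst%:E * (conc_dyn M F mu_dyn mu_goal pi * (rate_dyn F G Pi delta n m)%:E +
                 conc_goal M G mu_goal pi * (rate_goal G delta m)%:E))%E].
Proof.
(* The constant is [8 * 4]: 8 from the term in [LI / n] of [class_concentration], 4 from [LI4]
   below. *)
exists 32 => [|K K32 gamma /andP[g0 g1]]; first by rewrite ltr0n.
have K0 : 0 < K by apply: lt_le_trans K32; rewrite ltr0n.
have Cst0 : 0 < 4 * K + (2 * (1 - gamma))^-1 + 7.
  by rewrite !addr_gt0 ?mulr_gt0 ?invr_gt0 ?mulr_gt0 ?subr_gt0.
exists (4 * K + (2 * (1 - gamma))^-1 + 7) => //.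
move=> dS dA dC S A C M disc mu_dyn mu_goal dis gcons F G Pi adm rea compl
  dO Omega Pr n m Ddyn Dgoal n0 m0 iid delta d01.
have [fF fG fP FP GP] := adm; have [FQ GR] := rea.
have /andP[d0 d1] := d01.
(* A union bound costs [log (3 N^2 / delta)], comparable to [log (N / delta)] only
   for [N >= 2]; with [N = 1] there is a single policy, hence no regret. *)
have [N1|N2] := leqP (card_set F * card_set G * card_set Pi) 1.
  exists setT; split => //.
    by rewrite probability_setT lee_fin gerBl ltW.
  move=> w _ pid [Ppid _] pi Ppi.
  have cP1 : (card_set Pi <= 1)%N.
    apply: leq_trans N1; rewrite leq_pmull// muln_gt0.
    by rewrite (card_set_gt0 fF (FQ _ Ppi)) (card_set_gt0 fG GR).
  rewrite (card_set_le1_eq fP cP1 Ppid Ppi) subee; last first.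
    by have /andP[J0 J1] := Jval01 M pi; rewrite ge0_fin_numE// (le_lt_trans J1)// ltry.
  have [_ FT] := compl _ _ _ (FQ _ Ppi) GR Ppi.
  have cd := conc_dyn_ge1 mu_dyn mu_goal (FQ _ Ppi) FT.
  have cg := conc_goal_ge1 pi mu_goal GR.
  apply: mule_ge0; first by rewrite lee_fin ltW.
  apply: adde_ge0; apply: mule_ge0; rewrite ?lee_fin ?addr_ge0 ?sqrtr_ge0//.
    exact: le_trans cd.
  exact: le_trans cg.
have [F0 G0 P0] : [/\ 0 < card_set F, 0 < card_set G & 0 < card_set Pi]%N.
  by move: N2; case: (card_set F) (card_set G) (card_set Pi) => [|f] [|g] [|p] //; rewrite ?muln0.
have [E [mE PE EP]] := class_concentration adm compl dis gcons F0 G0 P0 n0 m0 iid d0.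
exists E; split => // w Ew pid opt pi Ppi.
have [HI HJ HG] := EP w Ew.
have nR : 0 < n%:R :> R by rewrite ltr0n.
have mR : 0 < m%:R :> R by rewrite ltr0n.
have log_gt0 (a : nat) : (0 < a)%N -> 0 < ln (a%:R / delta).
  move=> a0; rewrite ln_gt0// ltr_pdivlMr// mul1r; apply: lt_le_trans d1 _.
  by rewrite ler1n.
have L0 : 0 < log_all F G Pi delta by apply: log_gt0; rewrite !muln_gt0 F0 G0.
have LG0 : 0 < log_goal G delta by exact: log_gt0.
have rho0 : 0 < rate_dyn F G Pi delta n m.
  by rewrite addr_gt0// sqrtr_gt0 divr_gt0.
have rho'0 : 0 < rate_goal G delta m by rewrite sqrtr_gt0 divr_gt0.
have rho'E : rate_goal G delta m ^+ 2 = log_goal G delta / m%:R.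
  by rewrite sqr_sqrtr// divr_ge0// ltW.
have rhoE : log_all F G Pi delta / n%:R + log_all F G Pi delta / m%:R <=
    rate_dyn F G Pi delta n m ^+ 2.
  have Lk k : 0 <= log_all F G Pi delta / k%:R by rewrite divr_ge0// ltW.
  rewrite /rate_dyn sqrrD !sqr_sqrtr//.
  by rewrite lerD2r lerDl mulrn_wge0// mulr_ge0 ?sqrtr_ge0.
rewrite -disc; apply: (regret_bound adm rea compl rho0 rho'0 K32 _ _ HG opt Ppi).
- move=> f f' g p Ff Ff' Gg Pp; apply: le_trans (HI _ _ _ _ Ff Ff' Gg Pp).
  (* With [N] the product of the three cardinalities, the argument of [LI] is at most
     [3 N^2 / delta], and [3 N^2 <= N^4] as [N >= 2]. *)
  set LI := ln _; have LI4 : LI <= 4 * log_all F G Pi delta.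
    apply: ln_tripled_le => //; rewrite ?ltr0n ?muln_gt0 ?F0 ?G0 ?P0//.
    rewrite -natrX -natrM ler_nat; move: N2 F0 G0 P0.
    move: (card_set F) (card_set G) (card_set Pi) => a b c N2 a0 b0 c0.
    apply: (@leq_trans (3 * (a * b * c) ^ 2)); last first.
      by rewrite (expnD _ 2 2) leq_mul2r (leq_trans _ (leq_mul N2 N2)) ?orbT.
    rewrite leq_mul2l /= (_ : (a * b * c) ^ 2 = (a * a * b * c) * (b * c))%N; last by ring.
    by rewrite leq_pmulr// muln_gt0 b0.
  have : LI / m%:R <= 4 * log_all F G Pi delta / m%:R by rewrite ler_pM2r ?invr_gt0.
  have : LI / n%:R <= 4 * log_all F G Pi delta / n%:R by rewrite ler_pM2r ?invr_gt0.
  have : 0 < log_all F G Pi delta / m%:R by rewrite divr_gt0.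
  move: rhoE; rewrite -!mulrA.
  move: (LI / _) (LI / _) (_ / n%:R) (_ / m%:R) (_ ^+ 2) (\int[_]_x _) => a b c e r i; lra.
- (* Likewise for the goal class: if it is a singleton, [g] is the reward. *)
  move=> g Gg; have [G1|G2] := leqP (card_set G) 1.
    rewrite (card_set_le1_eq fG G1 Gg GR).
    under eq_Rintegral do rewrite subrr expr0n /=.
    rewrite Rintegral_cst1; last exact: probability_setT.
    rewrite mul0r sub0r big1 ?mulr0 => [|j _]; last by rewrite subrr expr0n.
    by rewrite oppr_le0 mulr_ge0 ?sqr_ge0.
  apply: le_trans (HJ _ Gg); set LJ := ln _.
  (* Here [3 |G| <= |G|^3] as [|G| >= 2]; doubled, this 3 is the constant 6 of [goal_conc]. *)
  have LJ3 : LJ <= 3 * log_goal G delta.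
    apply: ln_tripled_le; rewrite ?ltr0n//.
    rewrite -natrX -natrM ler_nat expnSr leq_mul2r.
    by rewrite (leq_trans _ (leq_mul G2 G2)) ?orbT.
  have : LJ / m%:R <= 3 * log_goal G delta / m%:R by rewrite ler_pM2r ?invr_gt0.
  rewrite rho'E -!mulrA; lra.
Qed.
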